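(* Let $f,g:I\to\mathbb{R}$ be four times continuously differentiable functions on $I$ with nonvanishing first derivatives. Let $p=(p_1,p_2):I\to\mathbb{R}_+^2$ be a twice continuously differentiable function and let $q=(q_1,q_2):I\to\mathbb{R}_+^2$ be a function. Assume that the set $$P:=\{x\in I\mid p_1(x)=p_2(x)\}$$ is nowhere dense in $I$. Then the following assertions are equivalent to each other. (i) The invariance equation $$A_{f,p}(x,y)+A_{g,q}(x,y)=x+y$$ holds for every $(x,y)\in I^2$. (ii) There exists an open set $U\subseteq I^2$ containing the diagonal $\mathrm{diag}(I^2)$ such that $A_{f,p}(x,y)+A_{g,q}(x,y)=x+y$ holds for all $(x,y)\in U$. (iii) The function $q=(q_1,q_2):I\to\mathbb{R}_+^2$ is twice continuously differentiable and the system of equalities $$\partial_1 A_{f,p}+\partial_1 A_{g,q}=1,\qquad \partial_1\partial_2 A_{f,p}+\partial_1\partial_2 A_{g,q}=0,$$ $$\partial_1^2\partial_2 A_{f,p}+\partial_1^2\partial_2 A_{g,q}=0,\qquad \partial_1^2\partial_2^2 A_{f,p}+\partial_1^2\partial_2^2 A_{g,q}=0$$ holds on the diagonal $\mathrm{diag}(I^2)$. (iv) There exist a real constant $\gamma\in\mathbb{R}$ and solutions $u,v,w,z:I\to\mathbb{R}$ of the second-order linear differential equation $F''=\gamma F$ such that $v>0$ and $z>0$ hold on $I$, $\{u,v\}$ and $\{w,z\}$ are linearly independent, and $$f=\frac{u}{v},\qquad g=\frac{w}{z},\qquad\text{and}\qquad p_1q_1=p_2q_2=vz$$ hold on $I$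.
   Context: $I$ denotes a nonempty open real interval, and $\mathbb{R}_+$ denotes the set of positive real numbers. The diagonal is $\mathrm{diag}(I^2):=\{(x,x)\mid x\in I\}$. For a continuous strictly monotone function $f:I\to\mathbb{R}$ and a pair of positive functions $p=(p_1,p_2):I\to\mathbb{R}_+^2$, the two-variable generalized Bajraktarević mean $A_{f,p}:I^2\to I$ is defined by $$A_{f,p}(x,y):=f^{-1}\left(\frac{p_1(x)f(x)+p_2(y)f(y)}{p_1(x)+p_2(y)}\right)\qquad(x,y\in I).$$ $A_{g,q}$ is defined analogously from $g$ and $q$. $\partial_1$ and $\partial_2$ denote partial differentiation with respect to the first and second variable, respectively. *)

(* Defs.v *)
From Stdlib Require Import Reals List.
From Coquelicot Require Import Coquelicot.
Import ListNotations.
Open Scope R_scope.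

(* Functions on an interval I are total functions R -> R about which only the
   values on I matter: I is open, so these values determine the derivatives at
   points of I. *)

Definition nonempty_open_interval (I : R -> Prop) : Prop :=
  open I /\ (exists x : R, I x) /\
  (forall x y z : R, I x -> I y -> x <= z <= y -> I z).

Definition positive_on (I : R -> Prop) (h : R -> R) : Prop :=
  forall x : R, I x -> 0 < h x.

(* All orders k <= n are listed because [ex_derive_n h n] alone only says that
   the total function [Derive_n h (n - 1)] is differentiable, which does not
   imply that the lower derivatives exist. *)
Definition cont_diff_on (n : nat) (I : R -> Prop) (h : R -> R) : Prop :=
  (forall (k : nat) (x : R), (k <= n)%nat -> I x -> ex_derive_n h k x) /\
  (forall x : R, I x -> continuous (Derive_n h n) x).

(* Inverse of the restriction of f to I, meaningful on the image f(I) when f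
   is injective on I. *)
Definition inv_on (I : R -> Prop) (f : R -> R) (t : R) : R :=
  iota (fun x : R => I x /\ f x = t).

Definition bajraktarevic (I : R -> Prop) (f p1 p2 : R -> R) (x y : R) : R :=
  inv_on I f ((p1 x * f x + p2 y * f y) / (p1 x + p2 y)).

(* The closure of P has empty interior in the subspace topology of I: a
   relatively open set [V /\ I] contained in the closure of P is empty. *)
Definition nowhere_dense_in (I P : R -> Prop) : Prop :=
  forall V : R -> Prop, open V ->
    (forall x : R, I x -> V x -> adherence P x) ->
    forall x : R, I x -> ~ V x.

(* F'' = gamma F; [ex_derive F x] is needed for the same reason as above. *)
Definition solution_on (I : R -> Prop) (gamma : R) (F : R -> R) : Prop :=
  forall x : R, I x -> ex_derive F x /\ is_derive (Derive F) x (gamma * F x).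

Definition lin_indep_on (I : R -> Prop) (h k : R -> R) : Prop :=
  forall c d : R, (forall x : R, I x -> c * h x + d * k x = 0) ->
    c = 0 /\ d = 0.

Definition all_equivalent (l : list Prop) : Prop :=
  forall P Q : Prop, In P l -> In Q l -> (P <-> Q).

(* Main.v *)
Require Import Defs.
From Stdlib Require Import Reals List Lra Lia.
From Coquelicot Require Import Coquelicot.
Import ListNotations.
Open Scope R_scope.

(** The four assertions are proved in a circle: global invariance, local
    invariance, the partial differential equations on the diagonal, the linear
    equation [F'' = gamma F], and back. Everything rests on the implicit form of
    the mean [a = A x y],
      [p1 x (f a - f x) + p2 y (f a - f y) = 0].

    From the linear equation to global invariance. If [f = u / v], the
    implicit equation reads
      [p1 x v y K a x + p2 y v x K a y = 0], with [K s t = u s v t - u t v s].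
    Divided by the constant Wronskian, [K s t] solves [F'' = gamma F] in [s] with
    data 0, 1 at [s = t]. It is therefore a function of [s - t] determined by
    [gamma] alone, and the kernel of [w], [z] is proportional to [K]
    ([kernel_translation]). For [b = x + y - a] one has [b - x = y - a] and
    [y - b = a - x], so that, by [p1 q1 = p2 q2 = v z], the equation for [a] is
    the equation that characterizes [b] as the other mean.

    From local invariance to the partial differential equations. The only point
    is the regularity of [q]: off the diagonal the weight can be solved for in
    terms of [g] and [B = x + y - A] ([weight_regular]). After that the identity
    [A + B = x + y] is differentiated.

    From the partial differential equations to the linear equation. Put
    [r = p1 / (p1 + p2)], [s = 1 - r], let [al], [be] be the logarithmic
    derivatives of [p1 sqrt |f'|], [p2 sqrt |f'|] ([logw]), and let [k] be minus
    half of the Schwarzian derivative of [f] ([kap]). In these quantities, which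
    are invariant under the Moebius changes of [f] that preserve the mean, the
    derivatives of [A] on the diagonal are short ([mean_diagonal]):
      [A_1 = r], [A_12 = - r s (al + be)],
      [A_112 = r s ((r - s) (al^2 + 2 al be + k) - al')],
      [A_1122 = r s (2 (1 - 6 r s) (al be + k) (al + be)
                     + 2 (r - s) (al be' - al' be) + 2 r s k')].
    The first equation says that passing from [A] to [B] exchanges [r] and [s],
    that is [p1 q1 = p2 q2]. Combined with the logarithmic derivative of this
    identity, the second one says that [al] and [be] change sign. The third
    becomes [r s (r - s) (k_f - k_g) = 0]; by density of the points with
    [p1 <> p2] and by continuity, [k_f = k_g]. The fourth then becomes
    [4 r^2 s^2 k' = 0], so that [k] is a constant [gamma]. Finally
    [v = 1 / sqrt |f'|] always satisfies [v'' = k v], and so does [f v]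
    ([solutions_of_constant_kap]). *)

(** * Second-order jets *)

(** Regularity and Taylor coefficients are kept in one predicate, so that for a
    composite expression both are obtained by the same rules; the total
    function [Derive] could not tell a derivative from a junk value. *)
Definition jet (h : R -> R) (x a0 a1 a2 : R) : Prop :=
  exists h1 h2 : R -> R,
    h x = a0 /\ h1 x = a1 /\ h2 x = a2 /\
    locally x (fun t => is_derive h t (h1 t)) /\
    locally x (fun t => is_derive h1 t (h2 t)) /\
    continuous h2 x.

Lemma is_derive_Rmult (h k : R -> R) (x dh dk : R) :
  is_derive h x dh -> is_derive k x dk ->
  is_derive (fun t => h t * k t) x (dh * k x + h x * dk).
Proof.
  intros Hh Hk.
  exact (is_derive_mult h k x dh dk Hh Hk Rmult_comm).
Qed.

Lemma is_derive_Rplus (h k : R -> R) (x dh dk : R) :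
  is_derive h x dh -> is_derive k x dk ->
  is_derive (fun t => h t + k t) x (dh + dk).
Proof. exact (is_derive_plus h k x dh dk). Qed.

Lemma is_derive_Rcomp (h k : R -> R) (x dh dk : R) :
  is_derive h (k x) dh -> is_derive k x dk ->
  is_derive (fun t => h (k t)) x (dh * dk).
Proof.
  intros Hh Hk.
  rewrite Rmult_comm.
  exact (is_derive_comp h k x dh dk Hh Hk).
Qed.

Lemma is_derive_continuous (h : R -> R) (x d : R) :
  is_derive h x d -> continuous h x.
Proof.
  intros H. apply (ex_derive_continuous (V := R_NormedModule)).
  exists d. exact H.
Qed.

Lemma jet_eq (h : R -> R) (x a0 a1 a2 b0 b1 b2 : R) :
  jet h x a0 a1 a2 -> a0 = b0 -> a1 = b1 -> a2 = b2 -> jet h x b0 b1 b2.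
Proof. intros H -> -> ->. exact H. Qed.

Lemma jet_val (h : R -> R) (x a0 a1 a2 : R) : jet h x a0 a1 a2 -> h x = a0.
Proof. intros (h1 & h2 & H & _). exact H. Qed.

Lemma jet_continuous (h : R -> R) (x a0 a1 a2 : R) :
  jet h x a0 a1 a2 -> continuous h x.
Proof.
  intros (h1 & h2 & _ & _ & _ & H & _).
  apply (is_derive_continuous _ _ (h1 x)).
  exact (locally_singleton _ _ H).
Qed.

Lemma jet_ext_loc (h k : R -> R) (x a0 a1 a2 : R) :
  locally x (fun t => h t = k t) -> jet h x a0 a1 a2 -> jet k x a0 a1 a2.
Proof.
  intros E (h1 & h2 & H0 & H1 & H2 & D1 & D2 & C).
  exists h1, h2. repeat split; trivial.
  - rewrite <- H0. symmetry. exact (locally_singleton _ _ E).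
  - generalize (filter_and _ _ (locally_locally _ _ E) D1).
    apply filter_imp. intros t [Et Dt].
    exact (is_derive_ext_loc _ _ _ _ Et Dt).
Qed.

Lemma jet_locally_Derive (h : R -> R) (x a0 a1 a2 : R) :
  jet h x a0 a1 a2 ->
  locally x (fun t => is_derive h t (Derive h t)) /\
  locally x (fun t => is_derive (Derive h) t (Derive (Derive h) t)) /\
  continuous (Derive (Derive h)) x /\
  Derive h x = a1 /\ Derive (Derive h) x = a2.
Proof.
  intros (h1 & h2 & H0 & H1 & H2 & D1 & D2 & C).
  assert (E1 : locally x (fun t => h1 t = Derive h t)).
  { generalize D1; apply filter_imp; intros t Ht.
    symmetry; exact (is_derive_unique _ _ _ Ht). }
  assert (D2' : locally x (fun t => is_derive (Derive h) t (h2 t))).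
  { generalize (filter_and _ _ (locally_locally _ _ E1) D2).
    apply filter_imp; intros t [Et Dt].
    exact (is_derive_ext_loc _ _ _ _ Et Dt). }
  assert (E2 : locally x (fun t => h2 t = Derive (Derive h) t)).
  { generalize D2'; apply filter_imp; intros t Ht.
    symmetry; exact (is_derive_unique _ _ _ Ht). }
  repeat split.
  - generalize (filter_and _ _ D1 E1); apply filter_imp.
    intros t [Ht Et]; rewrite <- Et; exact Ht.
  - generalize (filter_and _ _ D2' E2); apply filter_imp.
    intros t [Ht Et]; rewrite <- Et; exact Ht.
  - apply (continuous_ext_loc _ h2); trivial.
  - rewrite <- H1; symmetry; exact (locally_singleton _ _ E1).
  - rewrite <- H2; symmetry; exact (locally_singleton _ _ E2).
Qed.

Lemma jet_unique (h : R -> R) (x a0 a1 a2 b0 b1 b2 : R) :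
  jet h x a0 a1 a2 -> jet h x b0 b1 b2 -> a0 = b0 /\ a1 = b1 /\ a2 = b2.
Proof.
  intros Ha Hb.
  destruct (jet_locally_Derive _ _ _ _ _ Ha) as (_ & _ & _ & A1 & A2).
  destruct (jet_locally_Derive _ _ _ _ _ Hb) as (_ & _ & _ & B1 & B2).
  rewrite <- (jet_val _ _ _ _ _ Ha), <- (jet_val _ _ _ _ _ Hb).
  rewrite <- A1, <- A2, <- B1, <- B2. auto.
Qed.

Lemma jet_const (c x : R) : jet (fun _ => c) x c 0 0.
Proof.
  exists (fun _ => 0), (fun _ => 0). repeat split; trivial.
  - apply filter_forall; intros t. apply (is_derive_const (V := R_NormedModule)).
  - apply filter_forall; intros t. apply (is_derive_const (V := R_NormedModule)).
  - apply continuous_const.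
Qed.

Lemma jet_id (x : R) : jet (fun t => t) x x 1 0.
Proof.
  exists (fun _ => 1), (fun _ => 0). repeat split; trivial.
  - apply filter_forall; intros t. apply (is_derive_id (K := R_AbsRing)).
  - apply filter_forall; intros t. apply (is_derive_const (V := R_NormedModule)).
  - apply continuous_const.
Qed.

Lemma jet_plus (h k : R -> R) (x a0 a1 a2 b0 b1 b2 : R) :
  jet h x a0 a1 a2 -> jet k x b0 b1 b2 ->
  jet (fun t => h t + k t) x (a0 + b0) (a1 + b1) (a2 + b2).
Proof.
  intros (h1 & h2 & H0 & H1 & H2 & D1 & D2 & C)
         (k1 & k2 & K0 & K1 & K2 & D1' & D2' & C').
  exists (fun t => h1 t + k1 t), (fun t => h2 t + k2 t).
  repeat split; try congruence.
  - generalize (filter_and _ _ D1 D1'); apply filter_imp; intros t [U V].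
    exact (is_derive_plus _ _ _ _ _ U V).
  - generalize (filter_and _ _ D2 D2'); apply filter_imp; intros t [U V].
    exact (is_derive_plus _ _ _ _ _ U V).
  - exact (continuous_plus _ _ _ C C').
Qed.

Lemma jet_mult (h k : R -> R) (x a0 a1 a2 b0 b1 b2 : R) :
  jet h x a0 a1 a2 -> jet k x b0 b1 b2 ->
  jet (fun t => h t * k t) x
    (a0 * b0) (a1 * b0 + a0 * b1) (a2 * b0 + 2 * a1 * b1 + a0 * b2).
Proof.
  intros (h1 & h2 & H0 & H1 & H2 & D1 & D2 & C)
         (k1 & k2 & K0 & K1 & K2 & D1' & D2' & C').
  exists (fun t => h1 t * k t + h t * k1 t),
    (fun t => (h2 t * k t + h1 t * k1 t) + (h1 t * k1 t + h t * k2 t)).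
  repeat split; try congruence.
  - rewrite H0, H1, H2, K0, K1, K2; ring.
  - generalize (filter_and _ _ D1 D1'); apply filter_imp; intros t [U V].
    exact (is_derive_Rmult _ _ _ _ _ U V).
  - generalize (filter_and _ _ (filter_and _ _ D1 D1') (filter_and _ _ D2 D2')).
    apply filter_imp; intros t [[U V] [U' V']].
    exact (is_derive_plus _ _ _ _ _ (is_derive_Rmult _ _ _ _ _ U' V)
             (is_derive_Rmult _ _ _ _ _ U V')).
  - apply locally_singleton in D1, D1', D2, D2'.
    apply is_derive_continuous in D1, D1', D2, D2'.
    exact (continuous_plus _ _ _
      (continuous_plus _ _ _ (continuous_mult _ _ _ C D1')
         (continuous_mult _ _ _ D2 D2'))
      (continuous_plus _ _ _ (continuous_mult _ _ _ D2 D2')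
         (continuous_mult _ _ _ D1 C'))).
Qed.

Lemma jet_comp (h k : R -> R) (x a0 a1 a2 b0 b1 b2 : R) :
  jet k x b0 b1 b2 -> jet h b0 a0 a1 a2 ->
  jet (fun t => h (k t)) x a0 (a1 * b1) (a2 * b1 * b1 + a1 * b2).
Proof.
  intros Hk.
  assert (Ck := jet_continuous _ _ _ _ _ Hk).
  destruct Hk as (k1 & k2 & K0 & K1 & K2 & D1' & D2' & C').
  subst b0.
  intros (h1 & h2 & H0 & H1 & H2 & D1 & D2 & C).
  assert (D1k := Ck _ D1). assert (D2k := Ck _ D2).
  unfold filtermap in D1k, D2k.
  exists (fun t => h1 (k t) * k1 t),
    (fun t => (h2 (k t) * k1 t) * k1 t + h1 (k t) * k2 t).
  repeat split; try congruence.
  - generalize (filter_and _ _ D1' D1k); apply filter_imp; intros t [U V].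
    exact (is_derive_Rcomp _ _ _ _ _ V U).
  - generalize (filter_and _ _ (filter_and _ _ D1' D2') D2k).
    apply filter_imp; intros t [[U V] W].
    exact (is_derive_Rmult _ _ _ _ _ (is_derive_Rcomp _ _ _ _ _ W U) V).
  - apply locally_singleton in D1, D1', D2, D2'.
    apply is_derive_continuous in D1, D1', D2, D2'.
    exact (continuous_plus _ _ _
      (continuous_mult _ _ _
         (continuous_mult _ _ _ (continuous_comp _ _ _ Ck C) D2') D2')
      (continuous_mult _ _ _ (continuous_comp _ _ _ Ck D2) C')).
Qed.

Lemma jet_Rinv (y : R) : y <> 0 -> jet Rinv y (/ y) (- / y ^ 2) (2 / y ^ 3).
Proof.
  intros Hy.
  assert (N : locally y (fun t => t <> 0)).
  { apply (open_neq 0). exact Hy. }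
  exists (fun t => - / t ^ 2), (fun t => 2 / t ^ 3).
  repeat split; trivial.
  - generalize N; apply filter_imp; intros t Ht.
    auto_derive; trivial. field; trivial.
  - generalize N; apply filter_imp; intros t Ht.
    auto_derive; [ exact (pow_nonzero t 2 Ht) | field; trivial ].
  - apply (ex_derive_continuous (V := R_NormedModule)).
    auto_derive. exact (pow_nonzero y 3 Hy).
Qed.

Lemma jet_inv (h : R -> R) (x a0 a1 a2 : R) :
  jet h x a0 a1 a2 -> a0 <> 0 ->
  jet (fun t => / h t) x (/ a0)
    (- / a0 ^ 2 * a1) (2 / a0 ^ 3 * a1 * a1 + - / a0 ^ 2 * a2).
Proof.
  intros H H0. exact (jet_comp _ _ _ _ _ _ _ _ _ H (jet_Rinv _ H0)).
Qed.

Lemma jet_opp (h : R -> R) (x a0 a1 a2 : R) :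
  jet h x a0 a1 a2 -> jet (fun t => - h t) x (- a0) (- a1) (- a2).
Proof.
  intros H.
  apply (jet_ext_loc (fun t => -1 * h t)).
  { apply filter_forall; intros t; ring. }
  eapply jet_eq; [ apply (jet_mult _ _ _ _ _ _ _ _ _ (jet_const (-1) x) H) | | | ];
    ring.
Qed.

(** Computes the jet of an expression built by the field operations from the
    identity, constants and functions whose jets are hypotheses; the values are
    left to unification, and only the denominators remain as goals. *)
Ltac jets :=
  match goal with
  | H : jet ?h ?x _ _ _ |- jet ?h ?x _ _ _ => exact H
  | |- jet (fun _ => ?c) _ _ _ _ => apply jet_const
  | |- jet (fun t => t) _ _ _ _ => apply jet_id
  | |- jet (fun t => _ + _) _ _ _ _ => eapply jet_plus; jets
  | |- jet (fun t => _ - _) _ _ _ _ => eapply jet_plus; [ jets | eapply jet_opp; jets ]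
  | |- jet (fun t => - _) _ _ _ _ => eapply jet_opp; jets
  | |- jet (fun t => _ * _) _ _ _ _ => eapply jet_mult; jets
  | |- jet (fun t => _ / _) _ _ _ _ =>
      eapply jet_mult; [ jets | eapply jet_inv; [ jets | ] ]
  | |- jet (fun t => / _) _ _ _ _ => eapply jet_inv; [ jets | ]
  | |- _ => idtac
  end.

(** * Regular generators and their inverses *)

Lemma interval_between (I : R -> Prop) (x y z : R) :
  nonempty_open_interval I -> I x -> I y -> Rmin x y <= z <= Rmax x y -> I z.
Proof.
  intros (_ & _ & H) Hx Hy Hz.
  destruct (Rle_dec x y) as [L | L].
  - rewrite Rmin_left, Rmax_right in Hz by lra. exact (H x y z Hx Hy Hz).
  - rewrite Rmin_right, Rmax_left in Hz by lra. exact (H y x z Hy Hx Hz).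
Qed.

Lemma cont_diff_is_derive (n k : nat) (I : R -> Prop) (h : R -> R) (x : R) :
  cont_diff_on n I h -> (k < n)%nat -> I x ->
  is_derive (Derive_n h k) x (Derive_n h (S k) x).
Proof.
  intros [H _] Hk Hx. apply Derive_correct. exact (H (S k) x Hk Hx).
Qed.

Lemma cont_diff_continuous (n k : nat) (I : R -> Prop) (h : R -> R) (x : R) :
  cont_diff_on n I h -> (k <= n)%nat -> I x -> continuous (Derive_n h k) x.
Proof.
  intros H Hk Hx.
  destruct (Nat.eq_dec k n) as [-> | Ne].
  - exact (proj2 H x Hx).
  - apply (is_derive_continuous _ _ (Derive_n h (S k) x)).
    apply (cont_diff_is_derive n k I); trivial. lia.
Qed.

Lemma cont_diff_jet (n k : nat) (I : R -> Prop) (h : R -> R) (x : R) :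
  open I -> cont_diff_on n I h -> (k + 2 <= n)%nat -> I x ->
  jet (Derive_n h k) x (Derive_n h k x) (Derive_n h (S k) x)
    (Derive_n h (S (S k)) x).
Proof.
  intros oI H Hk Hx.
  exists (Derive_n h (S k)), (Derive_n h (S (S k))).
  repeat split; trivial.
  - generalize (oI x Hx); apply filter_imp; intros t It.
    apply (cont_diff_is_derive n k I); trivial; lia.
  - generalize (oI x Hx); apply filter_imp; intros t It.
    apply (cont_diff_is_derive n (S k) I); trivial; lia.
  - apply (cont_diff_continuous n (S (S k)) I); trivial; lia.
Qed.

Lemma jet_cont_diff (I : R -> Prop) (h : R -> R) :
  (forall x, I x -> exists a0 a1 a2, jet h x a0 a1 a2) -> cont_diff_on 2 I h.
Proof.
  intros H. split.
  - intros k x Hk Hx. destruct (H x Hx) as (a0 & a1 & a2 & J).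
    destruct (jet_locally_Derive _ _ _ _ _ J) as (D1 & D2 & _).
    destruct k as [ | [ | [ | k ]]]; try lia.
    + exact Logic.I.
    + eexists. exact (locally_singleton _ _ D1).
    + eexists. exact (locally_singleton _ _ D2).
  - intros x Hx. destruct (H x Hx) as (a0 & a1 & a2 & J).
    exact (proj1 (proj2 (proj2 (jet_locally_Derive _ _ _ _ _ J)))).
Qed.

(** The intermediate value theorem in the form of the implicit equation of the
    means; it yields both the existence of the means and the constant sign of a
    nonvanishing continuous derivative. *)
Lemma weighted_value (h : R -> R) (x y p q : R) :
  0 < p -> 0 < q ->
  (forall z, Rmin x y <= z <= Rmax x y -> continuous h z) ->
  exists a, Rmin x y <= a <= Rmax x y /\ p * (h a - h x) + q * (h a - h y) = 0.
Proof.
  intros Hp Hq.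
  assert (W : forall s k x y p q, 0 < p -> 0 < q -> s = 1 \/ s = -1 -> x < y ->
    s * k x < s * k y -> (forall z, x <= z <= y -> continuous k z) ->
    exists a, x <= a <= y /\ p * (k a - k x) + q * (k a - k y) = 0).
  { clear. intros s k x y p q Hp Hq Hs L Lk C.
    destruct (Ranalysis5.IVT_interv
      (fun a => s * (p * (k a - k x) + q * (k a - k y))) x y) as (a & Ha & Ea);
      trivial.
    - intros z Hz. apply continuity_pt_filterlim.
      assert (Cz := C z Hz).
      apply (continuous_scal_r s
               (fun a => p * (k a - k x) + q * (k a - k y))).
      apply (continuous_plus (fun a => p * (k a - k x)) (fun a => q * (k a - k y))).
      + apply (continuous_scal_r p (fun a => k a - k x)).
        apply (continuous_minus k (fun _ => k x)); trivial. apply continuous_const.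
      + apply (continuous_scal_r q (fun a => k a - k y)).
        apply (continuous_minus k (fun _ => k y)); trivial. apply continuous_const.
    - nra.
    - nra.
    - exists a; split; trivial. destruct Hs; subst s; lra. }
  intros C.
  destruct (Req_dec (h x) (h y)) as [E | N].
  { exists x. split. split; [ apply Rmin_l | apply Rmax_l ]. rewrite E; ring. }
  destruct (Rtotal_order x y) as [L | [E | L]].
  - rewrite Rmin_left, Rmax_right in * by lra.
    destruct (Rtotal_order (h x) (h y)) as [Lh | [E | Lh]]; [ | easy | ].
    + apply (W 1); auto; lra.
    + apply (W (-1)); auto; lra.
  - subst y; lra.
  - rewrite Rmin_right, Rmax_left in * by lra.
    assert (V : exists a, y <= a <= x /\ q * (h a - h y) + p * (h a - h x) = 0).
    { destruct (Rtotal_order (h y) (h x)) as [Lh | [E | Lh]];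
        [ | symmetry in E; easy | ].
      + apply (W 1); auto; lra.
      + apply (W (-1)); auto; lra. }
    destruct V as (a & Ha & Ea). exists a; split; trivial. lra.
Qed.

(** The intermediate value theorem applied to [f'] turns nonvanishing into a
    constant sign. *)
Lemma derive_sign (I : R -> Prop) (f : R -> R) :
  nonempty_open_interval I -> (forall x, I x -> continuous (Derive f) x) ->
  (forall x, I x -> Derive f x <> 0) ->
  exists s, (s = 1 \/ s = -1) /\ forall x, I x -> 0 < s * Derive f x.
Proof.
  intros hI C N. destruct (proj1 (proj2 hI)) as [x0 I0].
  assert (K : forall x y, I x -> I y -> Derive f x < 0 -> Derive f y < 0).
  { intros x y Ix Iy Lx.
    destruct (Rlt_dec (Derive f y) 0) as [L | L]; trivial. exfalso.
    assert (Ly : 0 < Derive f y) by (specialize (N y Iy); lra).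
    (* weights that make the weighted mean of the two derivatives vanish *)
    destruct (weighted_value (Derive f) x y (Derive f y) (- Derive f x))
      as (a & Ha & Ea); try lra.
    { intros z Hz. apply C. exact (interval_between I x y z hI Ix Iy Hz). }
    apply (N a). exact (interval_between I x y a hI Ix Iy Ha). nra. }
  destruct (Rlt_dec (Derive f x0) 0) as [L | L].
  - exists (-1). split; auto. intros x Ix. specialize (K x0 x I0 Ix L). lra.
  - exists 1. split; auto. intros x Ix.
    destruct (Rlt_dec (Derive f x) 0) as [L' | L'].
    + specialize (K x x0 Ix I0 L'). lra.
    + specialize (N x Ix). lra.
Qed.

Lemma derive_sign_increasing (I : R -> Prop) (f : R -> R) (s : R) :
  nonempty_open_interval I -> (forall x, I x -> is_derive f x (Derive f x)) ->
  (forall x, I x -> 0 < s * Derive f x) ->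
  forall x y, I x -> I y -> x < y -> s * f x < s * f y.
Proof.
  intros hI D P x y Ix Iy L.
  destruct (MVT_gen f x y (Derive f)) as (c & Hc & Ec).
  - intros z Hz. apply D. apply (interval_between I x y z hI Ix Iy). lra.
  - intros z Hz. apply continuity_pt_filterlim.
    apply (is_derive_continuous f z (Derive f z)), D.
    exact (interval_between I x y z hI Ix Iy Hz).
  - assert (Pc := P c (interval_between I x y c hI Ix Iy Hc)).
    assert (0 < s * Derive f c * (y - x)) by (apply Rmult_lt_0_compat; lra).
    nra.
Qed.

Lemma injective_on (I : R -> Prop) (f : R -> R) :
  nonempty_open_interval I -> (forall x, I x -> is_derive f x (Derive f x)) ->
  (forall x, I x -> continuous (Derive f) x) ->
  (forall x, I x -> Derive f x <> 0) ->
  forall x y, I x -> I y -> f x = f y -> x = y.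
Proof.
  intros hI D C N x y Ix Iy E.
  destruct (derive_sign I f hI C N) as (s & _ & P).
  assert (M := derive_sign_increasing I f s hI D P).
  destruct (Rtotal_order x y) as [L | [L | L]]; trivial.
  - specialize (M x y Ix Iy L). rewrite E in M. lra.
  - specialize (M y x Iy Ix L). rewrite E in M. lra.
Qed.

(** Caratheodory's form of differentiability. *)
Lemma is_derive_slope (h : R -> R) (x l : R) :
  is_derive h x l ->
  exists Q, continuous Q x /\ Q x = l /\
    forall y, h y - h x = Q y * (y - x).
Proof.
  intros H.
  exists (fun y => if Req_EM_T y x then l else (h y - h x) / (y - x)).
  repeat split.
  - apply is_derive_Reals in H.
    intros P [eps HP].
    destruct (H eps (cond_pos eps)) as [delta Hd].
    exists delta. intros y Hy. apply HP.
    destruct (Req_EM_T x x) as [_ | ]; [ | easy ].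
    destruct (Req_EM_T y x) as [ | Ny]; [ apply ball_center | ].
    specialize (Hd (y - x) ltac:(lra) Hy).
    rewrite (Rplus_minus x y) in Hd. exact Hd.
  - destruct (Req_EM_T x x); easy.
  - intros y. destruct (Req_EM_T y x) as [-> | Ny]; [ ring | ]. field. lra.
Qed.

Lemma slope_is_derive (h Q : R -> R) (x : R) :
  continuous Q x -> locally x (fun y => h y - h x = Q y * (y - x)) ->
  is_derive h x (Q x).
Proof.
  intros C E. apply is_derive_Reals. intros eps Heps.
  destruct (filter_and _ _ E (C _ (locally_ball (Q x) (mkposreal eps Heps))))
    as [delta Hd].
  exists delta. intros d Nd Ld.
  assert (B : ball x delta (x + d)).
  { change (Rabs (x + d - x) < delta). replace (x + d - x) with d by ring. exact Ld. }
  destruct (Hd _ B) as [E' B'].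
  rewrite E'. replace (Q (x + d) * (x + d - x) / d) with (Q (x + d)) by (field; trivial).
  exact B'.
Qed.

(** By monotonicity of [f], the value [phi t] stays within [d] of [phi t0] as soon
    as [F t] lies between [f (phi t0 - d)] and [f (phi t0 + d)]. *)
Lemma continuous_implicit (I : R -> Prop) (f F phi : R -> R) (t0 : R) :
  nonempty_open_interval I -> (forall x, I x -> is_derive f x (Derive f x)) ->
  (forall x, I x -> continuous (Derive f) x) ->
  (forall x, I x -> Derive f x <> 0) ->
  locally t0 (fun t => I (phi t) /\ f (phi t) = F t) ->
  continuous F t0 -> continuous phi t0.
Proof.
  intros hI D C N HF CF P [eps HP].
  destruct (derive_sign I f hI C N) as (s & Hs & Pos).
  assert (M := derive_sign_increasing I f s hI D Pos).
  destruct (locally_singleton _ _ HF) as [I0 E0].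
  destruct (proj1 hI _ I0) as [e He].
  set (d := Rmin eps e / 2).
  assert (Hd : 0 < d /\ d < eps /\ d < e).
  { assert (A := cond_pos eps). assert (B := cond_pos e).
    assert (0 < Rmin eps e) by (apply Rmin_pos; trivial).
    assert (X := Rmin_l eps e). assert (Y := Rmin_r eps e). unfold d; lra. }
  assert (Il : I (phi t0 - d)).
  { apply He. change (Rabs (phi t0 - d - phi t0) < e).
    apply Rabs_def1; lra. }
  assert (Ir : I (phi t0 + d)).
  { apply He. change (Rabs (phi t0 + d - phi t0) < e).
    apply Rabs_def1; lra. }
  assert (Ml := M _ _ Il I0 ltac:(lra)). assert (Mr := M _ _ I0 Ir ltac:(lra)).
  assert (CsF : continuous (fun t => s * F t) t0) by exact (continuous_scal_r s F t0 CF).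
  rewrite E0 in Ml, Mr.
  assert (L1 : locally t0 (fun t => s * f (phi t0 - d) < s * F t)).
  { apply (CsF (fun z => s * f (phi t0 - d) < z)). apply (open_gt _ _ Ml). }
  assert (L2 : locally t0 (fun t => s * F t < s * f (phi t0 + d))).
  { apply (CsF (fun z => z < s * f (phi t0 + d))). apply (open_lt _ _ Mr). }
  generalize (filter_and _ _ HF (filter_and _ _ L1 L2)).
  unfold filtermap. apply filter_imp. intros t [[It Et] [Ht1 Ht2]].
  apply HP. change (Rabs (phi t - phi t0) < eps). rewrite <- Et in Ht1, Ht2.
  apply Rabs_def1.
  - destruct (Rlt_dec (phi t) (phi t0 + d)) as [L | L]; [ lra | ].
    destruct (Req_dec (phi t) (phi t0 + d)) as [E | E].
    + rewrite E in Ht2. lra.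
    + specialize (M _ _ Ir It ltac:(lra)). lra.
  - destruct (Rlt_dec (phi t0 - d) (phi t)) as [L | L]; [ lra | ].
    destruct (Req_dec (phi t) (phi t0 - d)) as [E | E].
    + rewrite E in Ht1. lra.
    + specialize (M _ _ It Il ltac:(lra)). lra.
Qed.

(** Dividing the two slope identities for [F] and [f] at corresponding points
    expresses the slope of [phi]. *)
Lemma is_derive_implicit (I : R -> Prop) (f F phi : R -> R) (t0 dF : R) :
  nonempty_open_interval I -> (forall x, I x -> is_derive f x (Derive f x)) ->
  (forall x, I x -> continuous (Derive f) x) ->
  (forall x, I x -> Derive f x <> 0) ->
  locally t0 (fun t => I (phi t) /\ f (phi t) = F t) ->
  is_derive F t0 dF -> is_derive phi t0 (dF * / Derive f (phi t0)).
Proof.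
  intros hI D C N HF DF.
  assert (Cphi := continuous_implicit I f F phi t0 hI D C N HF
                    (is_derive_continuous _ _ _ DF)).
  destruct (locally_singleton _ _ HF) as [I0 E0].
  destruct (is_derive_slope _ _ _ DF) as (QF & CQF & <- & EF).
  destruct (is_derive_slope _ _ _ (D _ I0)) as (Qf & CQf & <- & Ef).
  assert (N0 : Qf (phi t0) <> 0).
  { intros Z. apply (N _ I0). apply is_derive_unique.
    rewrite <- Z. apply slope_is_derive; trivial. apply filter_forall; trivial. }
  assert (CQ : continuous (fun t => Qf (phi t)) t0) by exact (continuous_comp _ _ _ Cphi CQf).
  apply (slope_is_derive phi (fun t => QF t * / Qf (phi t))).
  - apply (continuous_mult QF (fun t => / Qf (phi t)) t0 CQF).
    exact (continuous_Rinv_comp _ _ CQ N0).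
  - generalize (filter_and _ _ HF (CQ _ (open_neq 0 _ N0))).
    unfold filtermap.
    apply filter_imp. intros t [[It Et] Nt].
    specialize (Ef (phi t)). rewrite Et, E0, EF in Ef.
    apply (Rmult_eq_reg_l (Qf (phi t))); trivial.
    rewrite <- Ef. field; trivial.
Qed.

Lemma jet_implicit (I : R -> Prop) (f F phi : R -> R) (t0 b0 b1 b2 : R) :
  nonempty_open_interval I -> cont_diff_on 2 I f ->
  (forall x, I x -> Derive f x <> 0) ->
  locally t0 (fun t => I (phi t) /\ f (phi t) = F t) ->
  jet F t0 b0 b1 b2 -> exists a1 a2, jet phi t0 (phi t0) a1 a2.
Proof.
  intros hI Hf N HF (F1 & F2 & _ & _ & _ & D1 & D2 & C2).
  assert (D := fun x => cont_diff_is_derive 2 0 I f x Hf ltac:(lia)).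
  assert (D' := fun x => cont_diff_is_derive 2 1 I f x Hf ltac:(lia)).
  assert (C := fun x => cont_diff_continuous 2 1 I f x Hf ltac:(lia)).
  assert (C' := fun x => cont_diff_continuous 2 2 I f x Hf ltac:(lia)).
  assert (Dphi : locally t0 (fun t => is_derive phi t (F1 t * / Derive f (phi t)))).
  { generalize (filter_and _ _ (locally_locally _ _ HF) D1).
    apply filter_imp. intros t [Ht Dt].
    exact (is_derive_implicit I f F phi t _ hI D C N Ht Dt). }
  assert (Cphi := is_derive_continuous _ _ _ (locally_singleton _ _ Dphi)).
  destruct (locally_singleton _ _ HF) as [I0 _].
  do 2 eexists. exists (fun t => F1 t * / Derive f (phi t)).
  exists (fun t => F2 t * / Derive f (phi t) + F1 t *
    (- (Derive_n f 2 (phi t) * (F1 t * / Derive f (phi t)))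
       / Derive f (phi t) ^ 2)).
  split; [ reflexivity | ]. split; [ reflexivity | ]. split; [ reflexivity | ].
  split; [ trivial | ]. split.
  - generalize (filter_and _ _ HF (filter_and _ _ Dphi D2)).
    apply filter_imp. intros t [[It _] [Dt Dt2]].
    apply (is_derive_Rmult F1 (fun s => / Derive f (phi s))); trivial.
    apply (is_derive_inv (fun t => Derive f (phi t))); [ | exact (N _ It) ].
    exact (is_derive_Rcomp (Derive f) phi t _ _ (D' _ It) Dt).
  - assert (CF1 := is_derive_continuous _ _ _ (locally_singleton _ _ D2)).
    assert (Cf1 : continuous (fun t => Derive f (phi t)) t0)
      by exact (continuous_comp _ _ _ Cphi (C _ I0)).
    assert (Cf2 : continuous (fun t => Derive_n f 2 (phi t)) t0)
      by exact (continuous_comp _ _ _ Cphi (C' _ I0)).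
    assert (Ci : continuous (fun t => / Derive f (phi t)) t0)
      by exact (continuous_Rinv_comp _ _ Cf1 (N _ I0)).
    assert (Cii : continuous (fun t => / Derive f (phi t) ^ 2) t0).
    { apply (continuous_Rinv_comp (fun t => Derive f (phi t) ^ 2)).
      - exact (continuous_mult _ _ _ Cf1
                 (continuous_mult _ _ _ Cf1 (continuous_const 1 t0))).
      - exact (pow_nonzero _ 2 (N _ I0)). }
    exact (continuous_plus _ _ _ (continuous_mult _ _ _ C2 Ci)
      (continuous_mult _ _ _ CF1 (continuous_mult _ _ _
        (continuous_opp _ _ (continuous_mult _ _ _ Cf2 (continuous_mult _ _ _ CF1 Ci)))
        Cii))).
Qed.

(** * The means as functions of one variable *)

Lemma cont_diff_le (m n : nat) (I : R -> Prop) (h : R -> R) :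
  (m <= n)%nat -> cont_diff_on n I h -> cont_diff_on m I h.
Proof.
  intros L H. split.
  - intros k x Hk. apply (proj1 H). lia.
  - intros x Ix. apply (cont_diff_continuous n m I); trivial.
Qed.

Lemma bajraktarevic_swap (I : R -> Prop) (f p1 p2 : R -> R) (x y : R) :
  bajraktarevic I f p1 p2 x y = bajraktarevic I f p2 p1 y x.
Proof.
  unfold bajraktarevic. f_equal. f_equal; ring.
Qed.

Lemma bajraktarevic_unique (I : R -> Prop) (f p1 p2 : R -> R) (x y a : R) :
  nonempty_open_interval I -> cont_diff_on 2 I f ->
  (forall x, I x -> Derive f x <> 0) ->
  positive_on I p1 -> positive_on I p2 -> I x -> I y -> I a ->
  p1 x * (f a - f x) + p2 y * (f a - f y) = 0 ->
  bajraktarevic I f p1 p2 x y = a.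
Proof.
  intros hI Hf N P1 P2 Ix Iy Ia E.
  specialize (P1 x Ix). specialize (P2 y Iy).
  assert (V : f a = (p1 x * f x + p2 y * f y) / (p1 x + p2 y)).
  { apply (Rmult_eq_reg_l (p1 x + p2 y)); [ | lra ]. field_simplify; lra. }
  unfold bajraktarevic, inv_on. apply (iota_unique (V := R_CompleteNormedModule)).
  - intros b [Ib Eb]. rewrite <- V in Eb.
    apply (injective_on I f); trivial.
    + intros z. apply (cont_diff_is_derive 2 0 I f); trivial; lia.
    + intros z. apply (cont_diff_continuous 2 1 I f); trivial; lia.
  - split; trivial.
Qed.

Lemma bajraktarevic_spec (I : R -> Prop) (f p1 p2 : R -> R) (x y : R) :
  nonempty_open_interval I -> cont_diff_on 2 I f ->
  (forall x, I x -> Derive f x <> 0) ->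
  positive_on I p1 -> positive_on I p2 -> I x -> I y ->
  let a := bajraktarevic I f p1 p2 x y in
  Rmin x y <= a <= Rmax x y /\ I a /\
  p1 x * (f a - f x) + p2 y * (f a - f y) = 0.
Proof.
  intros hI Hf N P1 P2 Ix Iy.
  destruct (weighted_value f x y (p1 x) (p2 y) (P1 x Ix) (P2 y Iy))
    as (a & Ha & Ea).
  { intros z Hz. apply (cont_diff_continuous 2 0 I f); trivial; [ lia | ].
    exact (interval_between I x y z hI Ix Iy Hz). }
  assert (Ia := interval_between I x y a hI Ix Iy Ha).
  simpl. rewrite (bajraktarevic_unique I f p1 p2 x y a); auto.
Qed.

Lemma bajraktarevic_diag (I : R -> Prop) (f p1 p2 : R -> R) (x : R) :
  nonempty_open_interval I -> cont_diff_on 2 I f ->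
  (forall x, I x -> Derive f x <> 0) ->
  positive_on I p1 -> positive_on I p2 -> I x ->
  bajraktarevic I f p1 p2 x x = x.
Proof.
  intros hI Hf N P1 P2 Ix. apply bajraktarevic_unique; trivial. ring.
Qed.

Lemma bajraktarevic_jet_left (I : R -> Prop) (f p1 p2 : R -> R) (t y : R) :
  nonempty_open_interval I -> cont_diff_on 2 I f ->
  (forall x, I x -> Derive f x <> 0) ->
  positive_on I p1 -> positive_on I p2 -> cont_diff_on 2 I p1 ->
  I t -> I y ->
  exists a1 a2, jet (fun s => bajraktarevic I f p1 p2 s y) t
                  (bajraktarevic I f p1 p2 t y) a1 a2.
Proof.
  intros hI Hf N P1 P2 C1 It Iy.
  assert (Jf := cont_diff_jet 2 0 I f t (proj1 hI) Hf ltac:(lia) It).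
  assert (Jp := cont_diff_jet 2 0 I p1 t (proj1 hI) C1 ltac:(lia) It).
  change (Derive_n f 0) with f in Jf. change (Derive_n p1 0) with p1 in Jp.
  set (F := fun s => (p1 s * f s + p2 y * f y) / (p1 s + p2 y)).
  assert (JF : exists b0 b1 b2,
    jet F t b0 b1 b2).
  { unfold F. do 3 eexists. jets.
    specialize (P1 t It). specialize (P2 y Iy). lra. }
  destruct JF as (b0 & b1 & b2 & JF).
  apply (jet_implicit I f F (fun s => bajraktarevic I f p1 p2 s y) t b0 b1 b2
           hI Hf N); [ | exact JF ].
  generalize (proj1 hI t It); apply filter_imp; intros s Is.
  destruct (bajraktarevic_spec I f p1 p2 s y hI Hf N P1 P2 Is Iy) as (_ & Ia & Ea).
  split; trivial.
  specialize (P1 s Is). specialize (P2 y Iy).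
  unfold F. apply (Rmult_eq_reg_l (p1 s + p2 y)); [ | lra ]. field_simplify; lra.
Qed.

Lemma bajraktarevic_jet_right (I : R -> Prop) (f p1 p2 : R -> R) (x t : R) :
  nonempty_open_interval I -> cont_diff_on 2 I f ->
  (forall x, I x -> Derive f x <> 0) ->
  positive_on I p1 -> positive_on I p2 -> cont_diff_on 2 I p2 ->
  I x -> I t ->
  exists a1 a2, jet (bajraktarevic I f p1 p2 x) t
                  (bajraktarevic I f p1 p2 x t) a1 a2.
Proof.
  intros hI Hf N P1 P2 C2 Ix It.
  destruct (bajraktarevic_jet_left I f p2 p1 t x hI Hf N P2 P1 C2 It Ix)
    as (a1 & a2 & J).
  exists a1, a2. rewrite bajraktarevic_swap.
  apply (jet_ext_loc _ _ _ _ _ _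
    (filter_forall _ (fun s => bajraktarevic_swap I f p2 p1 s x)) J).
Qed.

(** * Taylor coefficients of a mean on the diagonal *)

(** Logarithmic derivative of [p * sqrt |f'|]: replacing [f] by a Moebius
    transform of itself, with the weights changed so as to keep the mean, leaves
    this quantity unchanged. *)
Definition logw (f p : R -> R) (x : R) : R :=
  Derive p x / p x + Derive_n f 2 x / (2 * Derive f x).

(** Minus half of the Schwarzian derivative of [f]; it is the quotient [v'' / v]
    for [v = 1 / sqrt |f'|]. *)
Definition kap (f : R -> R) (x : R) : R :=
  3 / 4 * (Derive_n f 2 x / Derive f x) ^ 2 - Derive_n f 3 x / (2 * Derive f x).

Lemma is_derive_logw (I : R -> Prop) (f p : R -> R) (x : R) :
  cont_diff_on 4 I f -> cont_diff_on 2 I p -> I x ->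
  Derive f x <> 0 -> p x <> 0 ->
  is_derive (logw f p) x
    (Derive_n p 2 x / p x - (Derive p x / p x) ^ 2
     + Derive_n f 3 x / (2 * Derive f x) - (Derive_n f 2 x / Derive f x) ^ 2 / 2).
Proof.
  intros Hf Hp Ix Nf Np.
  assert (D1 := cont_diff_is_derive 4 1 I f x Hf ltac:(lia) Ix).
  assert (D2 := cont_diff_is_derive 4 2 I f x Hf ltac:(lia) Ix).
  assert (D0' := cont_diff_is_derive 2 0 I p x Hp ltac:(lia) Ix).
  assert (D1' := cont_diff_is_derive 2 1 I p x Hp ltac:(lia) Ix).
  apply (is_derive_ext (fun t => Derive_n p 1 t / Derive_n p 0 t
    + / 2 * (Derive_n f 2 t / Derive_n f 1 t))).
  { intros t. unfold logw. change (Derive_n f 1 t) with (Derive f t).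
    change (Derive_n p 1 t) with (Derive p t). change (Derive_n p 0 t) with (p t).
    apply Rminus_diag_uniq. unfold Rdiv. rewrite Rinv_mult. ring. }
  evar_last.
  { exact (is_derive_Rplus _ _ _ _ _ (is_derive_div _ _ _ _ _ D1' D0' Np)
      (is_derive_scal _ _ (/ 2) _ (is_derive_div _ _ _ _ _ D2 D1 Nf))). }
  change (Derive_n f 1 x) with (Derive f x).
  change (Derive_n p 1 x) with (Derive p x). change (Derive_n p 0 x) with (p x).
  apply Rminus_diag_uniq. field. split; trivial.
Qed.

Lemma is_derive_kap (I : R -> Prop) (f : R -> R) (x : R) :
  cont_diff_on 4 I f -> I x -> Derive f x <> 0 ->
  is_derive (kap f) x
    (2 * Derive_n f 2 x * Derive_n f 3 x / Derive f x ^ 2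
     - 3 / 2 * (Derive_n f 2 x / Derive f x) ^ 3
     - Derive_n f 4 x / (2 * Derive f x)).
Proof.
  intros Hf Ix Nf.
  assert (D1 := cont_diff_is_derive 4 1 I f x Hf ltac:(lia) Ix).
  assert (D2 := cont_diff_is_derive 4 2 I f x Hf ltac:(lia) Ix).
  assert (D3 := cont_diff_is_derive 4 3 I f x Hf ltac:(lia) Ix).
  assert (D21 := is_derive_div _ _ _ _ _ D2 D1 Nf).
  assert (D31 := is_derive_div _ _ _ _ _ D3 D1 Nf).
  apply (is_derive_ext (fun t => 3 / 4 * (Derive_n f 2 t / Derive_n f 1 t *
    (Derive_n f 2 t / Derive_n f 1 t))
    + - / 2 * (Derive_n f 3 t / Derive_n f 1 t))).
  { intros t. unfold kap. change (Derive_n f 1 t) with (Derive f t).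
    apply Rminus_diag_uniq. unfold Rdiv. rewrite Rinv_mult. ring. }
  evar_last.
  { exact (is_derive_Rplus _ _ _ _ _
      (is_derive_scal _ _ (3 / 4) _ (is_derive_Rmult _ _ _ _ _ D21 D21))
      (is_derive_scal _ _ (- / 2) _ D31)). }
  change (Derive_n f 1 x) with (Derive f x).
  apply Rminus_diag_uniq. change (Derive_n f 1) with (Derive f) in *. field. trivial.
Qed.

Lemma linear_solve (c u e L : R) : c <> 0 -> c * (u - e) = L -> L = 0 -> u = e.
Proof. intros Hc E EL. rewrite EL in E. apply Rmult_integral in E. lra. Qed.

(** Implicit differentiation in the second variable: [a] stands for the mean with
    a fixed first argument, at which the weight and the generator take the
    values [p] and [f0]. The results are again polynomial equations, ready to be
    differentiated in the first variable. *)
Lemma mean_equations_right (f p2 a : R -> R) (p f0 x b c : R)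
  (Q Q1 Q2 f1 f2 a0 g0 g1 g2 : R) :
  jet p2 x Q Q1 Q2 -> jet f x (f x) f1 f2 -> jet a x a0 b c ->
  jet f a0 g0 g1 g2 ->
  locally x (fun z => p * (f (a z) - f0) + p2 z * (f (a z) - f z) = 0) ->
  (p + Q) * (g1 * b) + Q1 * (g0 - f x) - Q * f1 = 0 /\
  (p + Q) * (g2 * (b * b) + g1 * c) + 2 * Q1 * (g1 * b) + Q2 * (g0 - f x)
    - 2 * Q1 * f1 - Q * f2 = 0.
Proof.
  intros Jp Jf Ja Jg E.
  assert (Jfa := jet_comp f a _ _ _ _ _ _ _ Ja Jg).
  assert (J : jet (fun z => p * (f (a z) - f0) + p2 z * (f (a z) - f z)) x
    0 ((p + Q) * (g1 * b) + Q1 * (g0 - f x) - Q * f1)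
    ((p + Q) * (g2 * (b * b) + g1 * c) + 2 * Q1 * (g1 * b) + Q2 * (g0 - f x)
    - 2 * Q1 * f1 - Q * f2)).
  { eapply jet_eq; [ jets | | | ].
    - rewrite <- (jet_val _ _ _ _ _ Jg), <- (jet_val _ _ _ _ _ Jp),
        <- (jet_val _ _ _ _ _ Ja).
      transitivity (p * (f (a x) - f0) + p2 x * (f (a x) - f x));
        [ ring | exact (locally_singleton _ _ E) ].
    - ring.
    - ring. }
  assert (J0 := jet_ext_loc _ _ _ _ _ _
    (filter_imp _ _ (fun z (H : _ = 0) => eq_sym H) E) (jet_const 0 x)).
  destruct (jet_unique _ _ _ _ _ _ _ _ J J0) as (_ & H1 & H2). split; trivial.
Qed.

(** The hypotheses are the coefficients of the second-order jets, in the first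
    variable, of the defining equation and of its two derivatives in the second
    variable. They form a triangular linear system for the Taylor coefficients
    [a1, a2] of [A], [b0, b1, b2] of its derivative and [c0, c1, c2] of its second
    derivative in the second variable. *)
Lemma mean_diagonal_algebra
  (P P1 P2 Q Q1 Q2 f1 f2 f3 f4 al be dal dbe ka dka a1 a2 b0 b1 b2 c0 c1 c2 : R) :
  0 < P -> 0 < Q -> f1 <> 0 ->
  al = P1 / P + f2 / (2 * f1) -> be = Q1 / Q + f2 / (2 * f1) ->
  dal = P2 / P - (P1 / P) ^ 2 + f3 / (2 * f1) - (f2 / f1) ^ 2 / 2 ->
  dbe = Q2 / Q - (Q1 / Q) ^ 2 + f3 / (2 * f1) - (f2 / f1) ^ 2 / 2 ->
  ka = 3 / 4 * (f2 / f1) ^ 2 - f3 / (2 * f1) ->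
  dka = 2 * f2 * f3 / f1 ^ 2 - 3 / 2 * (f2 / f1) ^ 3 - f4 / (2 * f1) ->
  let r := P / (P + Q) in
  let s := Q / (P + Q) in
  let u1 := f1 * a1 in
  let u2 := f2 * a1 * a1 + f1 * a2 in
  let m0 := f1 * b0 in
  let m1 := f2 * a1 * b0 + f1 * b1 in
  let m2 := (f3 * a1 * a1 + f2 * a2) * b0 + 2 * (f2 * a1) * b1 + f1 * b2 in
  let n0 := f2 * (b0 * b0) + f1 * c0 in
  let n1 := f3 * a1 * (b0 * b0) + f2 * (2 * b0 * b1) + (f2 * a1 * c0 + f1 * c1) in
  let n2 := (f4 * a1 * a1 + f3 * a2) * (b0 * b0) + 2 * (f3 * a1) * (2 * b0 * b1)
            + f2 * (2 * b1 * b1 + 2 * b0 * b2)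
            + ((f3 * a1 * a1 + f2 * a2) * c0 + 2 * (f2 * a1) * c1 + f1 * c2) in
  (P + Q) * u1 - P * f1 = 0 ->
  (P + Q) * u2 + 2 * P1 * (u1 - f1) - P * f2 = 0 ->
  (P + Q) * m0 - Q * f1 = 0 ->
  (P + Q) * m1 + P1 * m0 + Q1 * u1 = 0 ->
  (P + Q) * m2 + 2 * P1 * m1 + P2 * m0 + Q1 * u2 = 0 ->
  (P + Q) * n0 + 2 * Q1 * m0 - 2 * Q1 * f1 - Q * f2 = 0 ->
  (P + Q) * n1 + P1 * n0 + 2 * Q1 * m1 + Q2 * u1 = 0 ->
  (P + Q) * n2 + 2 * P1 * n1 + P2 * n0 + 2 * Q1 * m2 + Q2 * u2 = 0 ->
  a1 = r /\ b1 = - (r * s * (al + be)) /\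
  b2 = r * s * ((r - s) * (al * al + 2 * al * be + ka) - dal) /\
  c2 = r * s * (2 * (1 - 6 * (r * s)) * (al * be + ka) * (al + be)
                + 2 * (r - s) * (al * dbe - dal * be) + 2 * (r * s) * dka).
Proof.
  intros HP HQ Hf Eal Ebe Edal Edbe Eka Edka r s u1 u2 m0 m1 m2 n0 n1 n2
    F1 F2 G0 G1 G2 K0 K1 K2.
  assert (HS : P + Q <> 0) by lra.
  assert (HP' : P <> 0) by lra. assert (HQ' : Q <> 0) by lra.
  (* Everything is expressed through the logarithmic quantities: the
     derivatives of the weights and of f disappear. *)
  set (ph := f2 / f1) in *.
  assert (Ef2 : f2 = f1 * ph) by (unfold ph; field; trivial).
  assert (Ef3 : f3 = f1 * (3 / 2 * ph ^ 2 - 2 * ka)) by (rewrite Eka; field; trivial).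
  assert (Ef4 : f4 = f1 * (3 * ph ^ 3 - 8 * ka * ph - 2 * dka))
    by (rewrite Edka, Eka; unfold ph; field; trivial).
  assert (EP : P = r * (P + Q)) by (unfold r; field; trivial).
  assert (EQ : Q = s * (P + Q)) by (unfold s; field; trivial).
  assert (EP1 : P1 = r * (P + Q) * (al - ph / 2))
    by (rewrite <- EP, Eal; unfold ph; field; auto).
  assert (EQ1 : Q1 = s * (P + Q) * (be - ph / 2))
    by (rewrite <- EQ, Ebe; unfold ph; field; auto).
  assert (EP2 : P2 = r * (P + Q) * (dal + al * al - al * ph + ka))
    by (rewrite <- EP, Edal, Eal, Eka; unfold ph; field; auto).
  assert (EQ2 : Q2 = s * (P + Q) * (dbe + be * be - be * ph + ka))
    by (rewrite <- EQ, Edbe, Ebe, Eka; unfold ph; field; auto).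
  assert (Es : s = 1 - r) by (unfold s, r; field; trivial).
  unfold u1, u2, m0, m1, m2, n0, n1, n2 in *.
  clear u1 u2 m0 m1 m2 n0 n1 n2 Eal Ebe Edal Edbe Eka Edka.
  clearbody ph r s.
  set (S := P + Q) in *. clearbody S.
  rewrite EP, EP1, EP2, EQ, EQ1, EQ2, Ef2, Ef3, Ef4 in *.

  subst s.
  assert (N : S * f1 <> 0) by (apply Rmult_integral_contrapositive_currified; trivial).
  assert (A1 : a1 = r) by (apply (linear_solve _ _ _ _ N) with (2 := F1); ring).
  subst a1.
  assert (A2 : a2 = 2 * r * (1 - r) * al)
    by (apply (linear_solve _ _ _ _ N) with (2 := F2); field).
  subst a2.
  assert (B0 : b0 = 1 - r) by (apply (linear_solve _ _ _ _ N) with (2 := G0); ring).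
  subst b0.
  assert (B1 : b1 = - (r * (1 - r) * (al + be)))
    by (apply (linear_solve _ _ _ _ N) with (2 := G1); field).
  subst b1.
  assert (B2 : b2 = r * (1 - r) * ((r - (1 - r)) * (al * al + 2 * al * be + ka) - dal))
    by (apply (linear_solve _ _ _ _ N) with (2 := G2); field).
  subst b2.
  assert (C0 : c0 = 2 * r * (1 - r) * be)
    by (apply (linear_solve _ _ _ _ N) with (2 := K0); field).
  subst c0.
  assert (C1 : c1 = - (r * (1 - r) * (2 * r * al * be - 2 * (1 - r) * be * (al + be)
      + dbe + be * be + ka)) + 2 * ka * r * (1 - r) ^ 2)
    by (apply (linear_solve _ _ _ _ N) with (2 := K1); field).
  subst c1.
  repeat split.
  apply (linear_solve _ _ _ _ N) with (2 := K2); field.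
Qed.

(** [A], [b] and [c] are functions of the first variable that satisfy three
    equations, each linear in its new unknown. This gives the regularity of [b]
    and [c] by division, and then their Taylor coefficients by comparing jets. *)
Lemma mean_diagonal (I : R -> Prop) (f p1 p2 : R -> R) (x : R) :
  nonempty_open_interval I -> cont_diff_on 4 I f ->
  (forall x, I x -> Derive f x <> 0) ->
  positive_on I p1 -> positive_on I p2 ->
  cont_diff_on 2 I p1 -> cont_diff_on 2 I p2 -> I x ->
  let A := bajraktarevic I f p1 p2 in
  let r := p1 x / (p1 x + p2 x) in
  let s := p2 x / (p1 x + p2 x) in
  let al := logw f p1 x in
  let be := logw f p2 x in
  let dal := Derive (logw f p1) x in
  let dbe := Derive (logw f p2) x in
  let b := fun t => Derive (A t) x in
  let c := fun t => Derive (Derive (A t)) x in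
  (forall t, I t -> jet (A t) x (A t x) (b t) (c t)) /\
  (exists a2, jet (fun t => A t x) x x r a2) /\
  (exists b0, jet b x b0 (- (r * s * (al + be)))
     (r * s * ((r - s) * (al * al + 2 * al * be + kap f x) - dal))) /\
  (exists c0 c1, jet c x c0 c1
     (r * s * (2 * (1 - 6 * (r * s)) * (al * be + kap f x) * (al + be)
        + 2 * (r - s) * (al * dbe - dal * be)
        + 2 * (r * s) * Derive (kap f) x))).
Proof.
  intros hI Hf N P1 P2 C1 C2 Ix A r s al be dal dbe b c.
  assert (Hf2 : cont_diff_on 2 I f) by (apply (cont_diff_le 2 4); trivial; lia).
  assert (Jz : forall t, I t -> jet (A t) x (A t x) (b t) (c t)).
  { intros t It.
    destruct (bajraktarevic_jet_right I f p1 p2 t x hI Hf2 N P1 P2 C2 It Ix)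
      as (a1 & a2 & J). fold A in J.
    destruct (jet_locally_Derive _ _ _ _ _ J) as (_ & _ & _ & <- & <-). exact J. }
  assert (Spec := fun t It => bajraktarevic_spec I f p1 p2 t x hI Hf2 N P1 P2 It Ix).
  fold A in Spec. simpl in Spec.
  assert (Jf : forall t, I t -> jet f t (f t) (Derive f t) (Derive_n f 2 t))
    by (intros t It; exact (cont_diff_jet 4 0 I f t (proj1 hI) Hf ltac:(lia) It)).
  assert (Jf1 : forall t, I t ->
    jet (Derive f) t (Derive f t) (Derive_n f 2 t) (Derive_n f 3 t))
    by (intros t It; exact (cont_diff_jet 4 1 I f t (proj1 hI) Hf ltac:(lia) It)).
  assert (Jf2 : forall t, I t ->
    jet (Derive_n f 2) t (Derive_n f 2 t) (Derive_n f 3 t) (Derive_n f 4 t))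
    by (intros t It; exact (cont_diff_jet 4 2 I f t (proj1 hI) Hf ltac:(lia) It)).
  assert (Jp1 : jet p1 x (p1 x) (Derive p1 x) (Derive_n p1 2 x))
    by exact (cont_diff_jet 2 0 I p1 x (proj1 hI) C1 ltac:(lia) Ix).
  assert (Jp2 : jet p2 x (p2 x) (Derive p2 x) (Derive_n p2 2 x))
    by exact (cont_diff_jet 2 0 I p2 x (proj1 hI) C2 ltac:(lia) Ix).
  set (a := fun t => A t x).
  assert (Ja : exists a1 a2, jet a x x a1 a2).
  { destruct (bajraktarevic_jet_left I f p1 p2 x x hI Hf2 N P1 P2 C1 Ix Ix)
      as (a1 & a2 & J).
    rewrite bajraktarevic_diag in J by trivial. exists a1, a2. exact J. }
  destruct Ja as (a1 & a2 & Ja).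
  (* The defining equation and its first two derivatives in the second variable. *)
  assert (E0 : forall t, I t ->
    0 = p1 t * (f (a t) - f t) + p2 x * (f (a t) - f x)).
  { intros t It. symmetry. exact (proj2 (proj2 (Spec t It))). }
  assert (E12 : forall t, I t ->
    (p1 t + p2 x) * (Derive f (a t) * b t) + Derive p2 x * (f (a t) - f x)
      - p2 x * Derive f x = 0 /\
    (p1 t + p2 x) * (Derive_n f 2 (a t) * (b t * b t) + Derive f (a t) * c t)
      + 2 * Derive p2 x * (Derive f (a t) * b t) + Derive_n p2 2 x * (f (a t) - f x)
      - 2 * Derive p2 x * Derive f x - p2 x * Derive_n f 2 x = 0).
  { intros t It. destruct (Spec t It) as (_ & Ia & _).
    apply (mean_equations_right f p2 (A t) (p1 t) (f t) x (b t) (c t) _ _ _ _ _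
             (a t)); auto.
    generalize (proj1 hI x Ix); apply filter_imp; intros z Iz.
    exact (proj2 (proj2 (bajraktarevic_spec I f p1 p2 t z hI Hf2 N P1 P2 It Iz))). }
  assert (E1 := fun t It => eq_sym (proj1 (E12 t It))).
  assert (E2 := fun t It => eq_sym (proj2 (E12 t It))).
  clear E12.
  assert (Pos : forall t, I t -> p1 t + p2 x <> 0 /\ Derive f (a t) <> 0).
  { intros t It. specialize (P1 t It). specialize (P2 x Ix). split; [ lra | ].
    apply N. exact (proj1 (proj2 (Spec t It))). }
  destruct (Pos x Ix) as [Sx _]. assert (Nx := N x Ix).
  assert (J0 := jet_comp f a _ _ _ _ _ _ _ Ja (Jf x Ix)).
  assert (J1 := jet_comp (Derive f) a _ _ _ _ _ _ _ Ja (Jf1 x Ix)).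
  assert (J2 := jet_comp (Derive_n f 2) a _ _ _ _ _ _ _ Ja (Jf2 x Ix)).
  specialize (Jf x Ix).
  assert (Loc := proj1 hI x Ix).
  assert (Jb : exists b0 b1 b2, jet b x b0 b1 b2).
  { do 3 eexists.
    apply (jet_ext_loc (fun t => (p2 x * Derive f x - Derive p2 x * (f (a t) - f x))
      * / (p1 t + p2 x) * / Derive f (a t))).
    - generalize Loc; apply filter_imp; intros t It.
      destruct (Pos t It) as [St Nt]. symmetry.
      apply (linear_solve _ _ _ _
               (Rmult_integral_contrapositive_currified _ _ St Nt))
        with (2 := eq_sym (E1 t It)).
      field; split; trivial.
    - jets; trivial. }
  destruct Jb as (b0 & b1 & b2 & Jb).
  assert (Jc : exists c0 c1 c2, jet c x c0 c1 c2).
  { do 3 eexists.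
    apply (jet_ext_loc (fun t => (p2 x * Derive_n f 2 x + 2 * Derive p2 x * Derive f x
        - Derive_n p2 2 x * (f (a t) - f x)
        - 2 * Derive p2 x * (Derive f (a t) * b t)
        - (p1 t + p2 x) * (Derive_n f 2 (a t) * (b t * b t)))
      * / (p1 t + p2 x) * / Derive f (a t))).
    - generalize Loc; apply filter_imp; intros t It.
      destruct (Pos t It) as [St Nt]. symmetry.
      apply (linear_solve _ _ _ _
               (Rmult_integral_contrapositive_currified _ _ St Nt))
        with (2 := eq_sym (E2 t It)).
      field; split; trivial.
    - jets; trivial. }
  destruct Jc as (c0 & c1 & c2 & Jc).
  assert (V : forall h, (forall t, I t -> 0 = h t) -> forall h0 h1 h2,
            jet h x h0 h1 h2 -> h0 = 0 /\ h1 = 0 /\ h2 = 0).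
  { intros h Hh h0 h1 h2 Jh.
    refine (jet_unique h x _ _ _ _ _ _ Jh (jet_ext_loc _ _ _ _ _ _ _ (jet_const 0 x))).
    generalize Loc; apply filter_imp; exact Hh. }
  edestruct (V _ E0) as (_ & F1 & F2). { jets. }
  edestruct (V _ E1) as (G0 & G1 & G2). { jets. }
  edestruct (V _ E2) as (K0 & K1 & K2). { jets. }
  clear V E0 E1 E2.
  destruct (mean_diagonal_algebra
    (p1 x) (Derive p1 x) (Derive_n p1 2 x) (p2 x) (Derive p2 x) (Derive_n p2 2 x)
    (Derive f x) (Derive_n f 2 x) (Derive_n f 3 x) (Derive_n f 4 x)
    al be dal dbe (kap f x) (Derive (kap f) x) a1 a2 b0 b1 b2 c0 c1 c2
    (P1 x Ix) (P2 x Ix) Nx) as (R1 & R2 & R3 & R4).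
  - reflexivity.
  - reflexivity.
  - apply is_derive_unique, (is_derive_logw I); trivial.
    specialize (P1 x Ix). lra.
  - apply is_derive_unique, (is_derive_logw I); trivial.
    specialize (P2 x Ix). lra.
  - reflexivity.
  - apply is_derive_unique, (is_derive_kap I); trivial.
  - rewrite <- F1; ring.
  - rewrite <- F2; ring.
  - rewrite <- G0; ring.
  - rewrite <- G1; ring.
  - rewrite <- G2; ring.
  - rewrite <- K0; ring.
  - rewrite <- K1; ring.
  - rewrite <- K2; ring.
  - fold r s in R1, R2, R3, R4. subst a1 b1 b2 c2.
    split; [ exact Jz | ]. split; [ exists a2; exact Ja | ].
    split; [ exists b0; exact Jb | exists c0, c1; exact Jc ].
Qed.

(** The partial derivatives of [A] are defined by iterated total operators; the
    jets identify them with actual Taylor coefficients. *)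
Lemma mean_partials (A : R -> R -> R) (x : R) (b c : R -> R)
  (a0 a1 a2 b0 b1 b2 c0 c1 c2 : R) (I : R -> Prop) :
  open I -> I x -> (forall t, I t -> jet (A t) x (A t x) (b t) (c t)) ->
  jet (fun t => A t x) x a0 a1 a2 -> jet b x b0 b1 b2 -> jet c x c0 c1 c2 ->
  partial_derive 1 0 A x x = a1 /\ partial_derive 1 1 A x x = b1 /\
  partial_derive 2 1 A x x = b2 /\ partial_derive 2 2 A x x = c2.
Proof.
  intros oI Ix J Ja Jb Jc.
  assert (Eb : locally x (fun t => b t = Derive (A t) x)).
  { generalize (oI x Ix); apply filter_imp; intros t It.
    destruct (jet_locally_Derive _ _ _ _ _ (J t It)) as (_ & _ & _ & E & _); auto. }
  assert (Ec : locally x (fun t => c t = Derive (Derive (A t)) x)).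
  { generalize (oI x Ix); apply filter_imp; intros t It.
    destruct (jet_locally_Derive _ _ _ _ _ (J t It)) as (_ & _ & _ & _ & E); auto. }
  destruct (jet_locally_Derive _ _ _ _ _ Ja) as (_ & _ & _ & Ea1 & _).
  destruct (jet_locally_Derive _ _ _ _ _ (jet_ext_loc _ _ _ _ _ _ Eb Jb))
    as (_ & _ & _ & Eb1 & Eb2).
  destruct (jet_locally_Derive _ _ _ _ _ (jet_ext_loc _ _ _ _ _ _ Ec Jc))
    as (_ & _ & _ & _ & Ec2).
  repeat split; assumption.
Qed.

(** * Local invariance implies the partial differential equations *)

Definition locally_invariant (I : R -> Prop) (A B : R -> R -> R) : Prop :=
  forall x, I x -> exists e : posreal, forall s t,
    Rabs (s - x) < e -> Rabs (t - x) < e ->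
    I s /\ I t /\ A s t + B s t = s + t.

(** Away from the diagonal the weight [q1] can be read off from the mean: with a
    fixed second argument [y], the defining equation of [B] is linear in
    [q1 s], and [B s y = s + y - A s y] is as smooth as [A]. *)
Lemma weight_regular (I : R -> Prop) (f g p1 p2 q1 q2 : R -> R) :
  nonempty_open_interval I -> cont_diff_on 2 I f -> cont_diff_on 2 I g ->
  (forall x, I x -> Derive f x <> 0) -> (forall x, I x -> Derive g x <> 0) ->
  positive_on I p1 -> positive_on I p2 -> positive_on I q1 -> positive_on I q2 ->
  cont_diff_on 2 I p1 ->
  locally_invariant I (bajraktarevic I f p1 p2) (bajraktarevic I g q1 q2) ->
  cont_diff_on 2 I q1.
Proof.
  intros hI Hf Hg Nf Ng P1 P2 Q1 Q2 C1 Inv.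
  apply jet_cont_diff. intros x Ix.
  destruct (Inv x Ix) as [e He].
  assert (Pe := cond_pos e).
  (* a second argument close to [x] but different from it *)
  set (y := x + e / 2).
  assert (Hy : Rabs (y - x) < e) by (unfold y; apply Rabs_def1; lra).
  assert (Iy : I y).
  { destruct (He y y Hy Hy) as [Iy _]; exact Iy. }
  set (m := fun s => s + y - bajraktarevic I f p1 p2 s y).
  assert (Near : forall s, Rabs (s - x) < e / 2 ->
    I s /\ I (m s) /\ q1 s * (g (m s) - g s) + q2 y * (g (m s) - g y) = 0 /\
    g (m s) - g s <> 0).
  { intros s Hs. destruct (He s y ltac:(lra) Hy) as (Is & _ & E).
    assert (Em : m s = bajraktarevic I g q1 q2 s y) by (unfold m; lra).
    destruct (bajraktarevic_spec I g q1 q2 s y hI Hg Ng Q1 Q2 Is Iy) as (_ & Im & EB).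
    rewrite <- Em in Im, EB. repeat split; trivial.
    intros Z. rewrite Z in EB.
    assert (Z' : g (m s) - g y = 0) by (specialize (Q2 y Iy); nra).
    assert (s = y).
    { apply (injective_on I g); trivial.
      - intros z. apply (cont_diff_is_derive 2 0 I g); trivial; lia.
      - intros z. apply (cont_diff_continuous 2 1 I g); trivial; lia.
      - lra. }
    subst s. unfold y in Hs. apply Rabs_def2 in Hs. lra. }
  destruct (Near x) as (_ & Im & _ & Nx).
  { rewrite Rminus_diag, Rabs_R0. lra. }
  destruct (bajraktarevic_jet_left I f p1 p2 x y hI Hf Nf P1 P2 C1 Ix Iy)
    as (a1 & a2 & Ja).
  assert (Jm : jet m x (m x) (1 - a1) (- a2)).
  { eapply jet_eq; [ unfold m; jets | | | ]; [ unfold m; ring | ring | ring ]. }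
  assert (Jg : jet g x (g x) (Derive g x) (Derive_n g 2 x))
    by exact (cont_diff_jet 2 0 I g x (proj1 hI) Hg ltac:(lia) Ix).
  assert (Jgm := jet_comp g m _ _ _ _ _ _ _ Jm
                   (cont_diff_jet 2 0 I g (m x) (proj1 hI) Hg ltac:(lia) Im)).
  change (Derive_n g 0) with g in Jgm.
  do 3 eexists.
  apply (jet_ext_loc (fun s => - q2 y * (g (m s) - g y) * / (g (m s) - g s))).
  - assert (Pe2 : 0 < e / 2) by lra.
    exists (mkposreal _ Pe2). intros s Hs.
    destruct (Near s Hs) as (_ & _ & E & Ns).
    symmetry. apply (linear_solve _ _ _ _ Ns) with (2 := E). field. trivial.
  - jets. exact Nx.
Qed.

(** Since the partial derivatives exist, they can be added, and the sum of the two
    means is [s + t] near the diagonal. *)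
Lemma invariance_partials (I : R -> Prop) (f g p1 p2 q1 q2 : R -> R) (x : R) :
  nonempty_open_interval I -> cont_diff_on 4 I f -> cont_diff_on 4 I g ->
  (forall x, I x -> Derive f x <> 0) -> (forall x, I x -> Derive g x <> 0) ->
  positive_on I p1 -> positive_on I p2 -> positive_on I q1 -> positive_on I q2 ->
  cont_diff_on 2 I p1 -> cont_diff_on 2 I p2 ->
  cont_diff_on 2 I q1 -> cont_diff_on 2 I q2 ->
  let A := bajraktarevic I f p1 p2 in
  let B := bajraktarevic I g q1 q2 in
  locally_invariant I A B -> I x ->
  partial_derive 1 0 A x x + partial_derive 1 0 B x x = 1 /\
  partial_derive 1 1 A x x + partial_derive 1 1 B x x = 0 /\
  partial_derive 2 1 A x x + partial_derive 2 1 B x x = 0 /\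
  partial_derive 2 2 A x x + partial_derive 2 2 B x x = 0.
Proof.
  intros hI Hf Hg Nf Ng P1 P2 Q1 Q2 C1 C2 D1 D2 A B Inv Ix.
  destruct (mean_diagonal I f p1 p2 x hI Hf Nf P1 P2 C1 C2 Ix)
    as (JA & (a2 & Ja) & (b0 & Jb) & (c0 & c1 & Jc)).
  destruct (mean_diagonal I g q1 q2 x hI Hg Ng Q1 Q2 D1 D2 Ix)
    as (JB & (a2' & Ja') & (b0' & Jb') & (c0' & c1' & Jc')).
  fold A in JA, Ja, Jb, Jc. fold B in JB, Ja', Jb', Jc'.
  set (b := fun t => Derive (A t) x) in *.
  set (c := fun t => Derive (Derive (A t)) x) in *.
  set (b' := fun t => Derive (B t) x) in *.
  set (c' := fun t => Derive (Derive (B t)) x) in *.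
  destruct (mean_partials A x b c _ _ _ _ _ _ _ _ _ I (proj1 hI) Ix JA Ja Jb Jc)
    as (-> & -> & -> & ->).
  destruct (mean_partials B x b' c' _ _ _ _ _ _ _ _ _ I (proj1 hI) Ix JB Ja' Jb' Jc')
    as (-> & -> & -> & ->).
  destruct (Inv x Ix) as [e He].
  assert (Hx : Rabs (x - x) < e)
    by (rewrite Rminus_diag, Rabs_R0; apply cond_pos).
  (* Near the diagonal [B s t = s + t - A s t], and this passes to the jets. *)
  assert (Sum : forall t, Rabs (t - x) < e ->
    t + x + - A t x = B t x /\ 1 + - b t = b' t /\ - c t = c' t).
  { intros t Ht. destruct (He t x Ht Hx) as (It & _ & _).
    specialize (JA t It). specialize (JB t It).
    change (jet (fun z => A t z) x (A t x) (b t) (c t)) in JA.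
    refine (jet_unique (B t) x _ _ _ _ _ _ _ JB).
    eapply jet_eq.
    - apply (jet_ext_loc (fun z => z + t + - A t z)).
      + exists e. intros z Hz. destruct (He t z Ht Hz) as (_ & _ & E). lra.
      + jets.
    - ring.
    - ring.
    - ring. }
  assert (Loc : locally x (fun t => Rabs (t - x) < e)) by (exists e; auto).
  assert (K : forall h, (forall t, Rabs (t - x) < e -> h t = 0) ->
    forall h0 h1 h2, jet h x h0 h1 h2 -> h0 = 0 /\ h1 = 0 /\ h2 = 0).
  { intros h Hh h0 h1 h2 Jh.
    refine (jet_unique h x _ _ _ _ _ _ Jh (jet_ext_loc _ _ _ _ _ _ _ (jet_const 0 x))).
    generalize Loc; apply filter_imp; intros t Ht. symmetry; auto. }
  edestruct (K (fun t => A t x + B t x - t + - x)) as (_ & E1 & _).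
  { intros t Ht. destruct (Sum t Ht) as (E & _). lra. }
  { jets. }
  edestruct (K (fun t => b t + b' t + - 1)) as (_ & E2 & E3).
  { intros t Ht. destruct (Sum t Ht) as (_ & E & _). lra. }
  { jets. }
  edestruct (K (fun t => c t + c' t)) as (_ & _ & E4).
  { intros t Ht. destruct (Sum t Ht) as (_ & _ & E). lra. }
  { jets. }
  repeat split; lra.
Qed.

(** * From the partial differential equations to the linear equation *)

Lemma solution_on_intro (I : R -> Prop) (gamma : R) (F F1 : R -> R) :
  open I -> (forall x, I x -> is_derive F x (F1 x)) ->
  (forall x, I x -> is_derive F1 x (gamma * F x)) -> solution_on I gamma F.
Proof.
  intros oI D1 D2 x Ix. split.
  - exists (F1 x). exact (D1 x Ix).
  - apply (is_derive_ext_loc F1); [ | exact (D2 x Ix) ].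
    generalize (oI x Ix); apply filter_imp; intros t It.
    symmetry. exact (is_derive_unique _ _ _ (D1 t It)).
Qed.

(** The hypothesis on [v] says that [v] is [1 / sqrt |f'|] up to a constant
    factor; the quotient [v'' / v] is then [kap f]. *)
Lemma solutions_of_constant_kap (I : R -> Prop) (gamma : R) (f v : R -> R) :
  open I -> cont_diff_on 4 I f -> (forall x, I x -> Derive f x <> 0) ->
  (forall x, I x -> kap f x = gamma) ->
  (forall x, I x ->
     is_derive v x (- / 2 * (Derive_n f 2 x / Derive_n f 1 x) * v x)) ->
  solution_on I gamma v /\ solution_on I gamma (fun x => f x * v x).
Proof.
  intros oI Hf N K Dv.
  assert (D0 := fun x => cont_diff_is_derive 4 0 I f x Hf ltac:(lia)).
  assert (D1 := fun x => cont_diff_is_derive 4 1 I f x Hf ltac:(lia)).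
  assert (D2 := fun x => cont_diff_is_derive 4 2 I f x Hf ltac:(lia)).
  change (Derive_n f 0) with f in D0.
  change (Derive_n f 1) with (Derive f) in *.
  set (l := fun x => - / 2 * (Derive_n f 2 x / Derive f x)).
  assert (Dl : forall x, I x -> is_derive l x
    (- / 2 * ((Derive_n f 3 x * Derive f x - Derive_n f 2 x * Derive_n f 2 x)
              / Derive f x ^ 2))).
  { intros x Ix.
    exact (is_derive_scal _ _ (- / 2) _
             (is_derive_div _ _ _ _ _ (D2 x Ix) (D1 x Ix) (N x Ix))). }
  assert (Dv' : forall x, I x -> is_derive v x (l x * v x)) by exact Dv.
  assert (Dlv : forall x, I x -> is_derive (fun t => l t * v t) x (gamma * v x)).
  { intros x Ix. evar_last.
    - exact (is_derive_Rmult _ _ _ _ _ (Dl x Ix) (Dv' x Ix)).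
    - rewrite <- (K x Ix). unfold l, kap. apply Rminus_diag_uniq. field. exact (N x Ix). }
  split.
  - exact (solution_on_intro I gamma v _ oI Dv' Dlv).
  - apply (solution_on_intro I gamma _
             (fun x => Derive f x * v x + f x * (l x * v x)) oI).
    + intros x Ix. exact (is_derive_Rmult _ _ _ _ _ (D0 x Ix) (Dv' x Ix)).
    + intros x Ix. evar_last.
      * exact (is_derive_Rplus _ _ _ _ _
          (is_derive_Rmult _ _ _ _ _ (D1 x Ix) (Dv' x Ix))
          (is_derive_Rmult _ _ _ _ _ (D0 x Ix) (Dlv x Ix))).
      * unfold l. apply Rminus_diag_uniq. field. exact (N x Ix).
Qed.

(** A linear relation between [f v] and [v] would make [f] constant. *)
Lemma lin_indep_quotient (I : R -> Prop) (f v : R -> R) :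
  nonempty_open_interval I -> positive_on I v ->
  (forall x, I x -> Derive f x <> 0) ->
  lin_indep_on I (fun x => f x * v x) v.
Proof.
  intros hI V N c d E.
  assert (E' : forall x, I x -> c * f x + d = 0).
  { intros x Ix. apply (Rmult_eq_reg_r (v x)).
    - rewrite Rmult_0_l, <- (E x Ix). ring.
    - specialize (V x Ix). lra. }
  destruct (proj1 (proj2 hI)) as [x Ix].
  assert (c = 0).
  { destruct (Req_dec c 0) as [ | Nc ]; trivial. exfalso.
    apply (N x Ix). apply is_derive_unique.
    apply (is_derive_ext_loc (fun _ => - d / c)).
    - generalize (proj1 hI x Ix); apply filter_imp; intros t It.
      specialize (E' t It). apply (Rmult_eq_reg_l c); trivial. field_simplify; lra.
    - apply (is_derive_const (V := R_NormedModule)). }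
  split; trivial. specialize (E' x Ix). subst c. lra.
Qed.

Lemma constant_on (I : R -> Prop) (h : R -> R) (x y : R) :
  nonempty_open_interval I -> (forall t, I t -> is_derive h t 0) ->
  I x -> I y -> h x = h y.
Proof.
  intros hI D Ix Iy.
  destruct (MVT_gen h x y (fun _ => 0)) as (c & _ & Ec); [ | | lra ].
  - intros z Hz. apply D. apply (interval_between I x y z hI Ix Iy). lra.
  - intros z Hz. apply continuity_pt_filterlim.
    apply (is_derive_continuous h z 0), D.
    exact (interval_between I x y z hI Ix Iy Hz).
Qed.

(** The points of [I] where [h] does not vanish form an open set contained in
    [P]. *)
Lemma zero_off_nowhere_dense (I P : R -> Prop) (h : R -> R) :
  open I -> nowhere_dense_in I P -> (forall x, I x -> continuous h x) ->
  (forall x, I x -> P x \/ h x = 0) -> forall x, I x -> h x = 0.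
Proof.
  intros oI ND C Z x Ix.
  destruct (Req_dec (h x) 0) as [ | Nx]; trivial. exfalso.
  apply (ND (fun t => I t /\ h t <> 0)) with (x := x); auto.
  - intros t [It Nt].
    generalize (filter_and _ _ (oI t It) (C t It _ (open_neq 0 _ Nt))).
    unfold filtermap. apply filter_imp. auto.
  - intros t It [_ Nt]. apply adherence_P1. destruct (Z t It); easy.
Qed.

(** Passing from [A] to [B] exchanges the relative weights and changes the signs
    of the logarithmic derivatives, so that in the sums of the formulas of
    [mean_diagonal] everything cancels except for the terms with [kap]. *)
Lemma partials_imply_kap (I : R -> Prop) (f g p1 p2 q1 q2 : R -> R) :
  nonempty_open_interval I -> cont_diff_on 4 I f -> cont_diff_on 4 I g ->
  (forall x, I x -> Derive f x <> 0) -> (forall x, I x -> Derive g x <> 0) ->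
  positive_on I p1 -> positive_on I p2 -> positive_on I q1 -> positive_on I q2 ->
  cont_diff_on 2 I p1 -> cont_diff_on 2 I p2 ->
  cont_diff_on 2 I q1 -> cont_diff_on 2 I q2 ->
  nowhere_dense_in I (fun x : R => I x /\ p1 x = p2 x) ->
  let A := bajraktarevic I f p1 p2 in
  let B := bajraktarevic I g q1 q2 in
  (forall x, I x ->
    partial_derive 1 0 A x x + partial_derive 1 0 B x x = 1 /\
    partial_derive 1 1 A x x + partial_derive 1 1 B x x = 0 /\
    partial_derive 2 1 A x x + partial_derive 2 1 B x x = 0 /\
    partial_derive 2 2 A x x + partial_derive 2 2 B x x = 0) ->
  exists gamma, forall x, I x ->
    kap f x = gamma /\ kap g x = gamma /\ p1 x * q1 x = p2 x * q2 x /\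
    logw f p1 x + logw g q1 x = 0.
Proof.
  intros hI Hf Hg Nf Ng P1 P2 Q1 Q2 C1 C2 D1 D2 ND A B E.
  assert (oI := proj1 hI).
  assert (X : forall x, I x ->
    let r := p1 x / (p1 x + p2 x) in let s := p2 x / (p1 x + p2 x) in
    let r' := q1 x / (q1 x + q2 x) in let s' := q2 x / (q1 x + q2 x) in
    let al := logw f p1 x in let be := logw f p2 x in
    let al' := logw g q1 x in let be' := logw g q2 x in
    let dal := Derive (logw f p1) x in let dbe := Derive (logw f p2) x in
    let dal' := Derive (logw g q1) x in let dbe' := Derive (logw g q2) x in
    r + r' = 1 /\
    - (r * s * (al + be)) + - (r' * s' * (al' + be')) = 0 /\
    r * s * ((r - s) * (al * al + 2 * al * be + kap f x) - dal) +
    r' * s' * ((r' - s') * (al' * al' + 2 * al' * be' + kap g x) - dal') = 0 /\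
    r * s * (2 * (1 - 6 * (r * s)) * (al * be + kap f x) * (al + be)
        + 2 * (r - s) * (al * dbe - dal * be)
        + 2 * (r * s) * Derive (kap f) x) +
    r' * s' * (2 * (1 - 6 * (r' * s')) * (al' * be' + kap g x) * (al' + be')
        + 2 * (r' - s') * (al' * dbe' - dal' * be')
        + 2 * (r' * s') * Derive (kap g) x) = 0).
  { intros x Ix.
    destruct (mean_diagonal I f p1 p2 x hI Hf Nf P1 P2 C1 C2 Ix)
      as (JA & (a2 & Ja) & (b0 & Jb) & (c0 & c1 & Jc)).
    destruct (mean_diagonal I g q1 q2 x hI Hg Ng Q1 Q2 D1 D2 Ix)
      as (JB & (a2' & Ja') & (b0' & Jb') & (c0' & c1' & Jc')).
    specialize (E x Ix).
    destruct (mean_partials A x _ _ _ _ _ _ _ _ _ _ _ I oI Ix JA Ja Jb Jc)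
      as (EA1 & EA2 & EA3 & EA4).
    destruct (mean_partials B x _ _ _ _ _ _ _ _ _ _ _ I oI Ix JB Ja' Jb' Jc')
      as (EB1 & EB2 & EB3 & EB4).
    rewrite EA1, EA2, EA3, EA4, EB1, EB2, EB3, EB4 in E. exact E. }
  clear E.
  assert (R1 : forall x, I x -> p1 x * q1 x = p2 x * q2 x).
  { intros x Ix. destruct (X x Ix) as (H & _). simpl in H.
    specialize (P1 x Ix). specialize (P2 x Ix).
    specialize (Q1 x Ix). specialize (Q2 x Ix).
    assert (H' : (p1 x + p2 x) * (q1 x + q2 x) *
      (p1 x / (p1 x + p2 x) + q1 x / (q1 x + q2 x)) =
      p1 x * (q1 x + q2 x) + q1 x * (p1 x + p2 x)) by (field; lra).
    rewrite H in H'. lra. }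
  assert (RS : forall x, I x ->
    let r := p1 x / (p1 x + p2 x) in let s := p2 x / (p1 x + p2 x) in
    q1 x / (q1 x + q2 x) = s /\ q2 x / (q1 x + q2 x) = r /\
    r + s = 1 /\ 0 < r /\ 0 < s /\ (r = s -> p1 x = p2 x)).
  { intros x Ix. destruct (X x Ix) as (H & _). simpl in H.
    specialize (P1 x Ix). specialize (P2 x Ix).
    specialize (Q1 x Ix). specialize (Q2 x Ix). simpl.
    assert (HS : p1 x / (p1 x + p2 x) + p2 x / (p1 x + p2 x) = 1) by (field; lra).
    assert (HS' : q1 x / (q1 x + q2 x) + q2 x / (q1 x + q2 x) = 1) by (field; lra).
    repeat split; try lra.
    - apply Rdiv_lt_0_compat; lra.
    - apply Rdiv_lt_0_compat; lra.
    - intros H0. apply (Rmult_eq_reg_r (/ (p1 x + p2 x))); [ exact H0 | ].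
      apply Rinv_neq_0_compat; lra. }
  (* Differentiating the logarithm of [p1 q1 = p2 q2]. *)
  assert (L : forall x, I x ->
    Derive p1 x / p1 x + Derive q1 x / q1 x = Derive p2 x / p2 x + Derive q2 x / q2 x).
  { intros x Ix.
    assert (d1 : is_derive p1 x (Derive p1 x))
      by exact (cont_diff_is_derive 2 0 I p1 x C1 ltac:(lia) Ix).
    assert (d2 : is_derive p2 x (Derive p2 x))
      by exact (cont_diff_is_derive 2 0 I p2 x C2 ltac:(lia) Ix).
    assert (e1 : is_derive q1 x (Derive q1 x))
      by exact (cont_diff_is_derive 2 0 I q1 x D1 ltac:(lia) Ix).
    assert (e2 : is_derive q2 x (Derive q2 x))
      by exact (cont_diff_is_derive 2 0 I q2 x D2 ltac:(lia) Ix).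
    assert (EQ : Derive p1 x * q1 x + p1 x * Derive q1 x
                 = Derive p2 x * q2 x + p2 x * Derive q2 x).
    { rewrite <- (is_derive_unique _ _ _ (is_derive_Rmult _ _ _ _ _ d1 e1)).
      apply is_derive_unique.
      apply (is_derive_ext_loc (fun t => p2 t * q2 t)).
      - generalize (oI x Ix); apply filter_imp; intros t It.
        symmetry; exact (R1 t It).
      - exact (is_derive_Rmult _ _ _ _ _ d2 e2). }
    specialize (R1 x Ix).
    specialize (P1 x Ix). specialize (P2 x Ix).
    specialize (Q1 x Ix). specialize (Q2 x Ix).
    transitivity ((Derive p1 x * q1 x + p1 x * Derive q1 x) / (p1 x * q1 x)).
    - field; lra.
    - rewrite R1, EQ. field; lra. }
  assert (R2 : forall x, I x ->
    logw g q1 x = - logw f p1 x /\ logw g q2 x = - logw f p2 x).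
  { intros x Ix. destruct (X x Ix) as (_ & H & _). simpl in H.
    destruct (RS x Ix) as (Er & Es & S1 & Hr & Hs & _). rewrite Er, Es in H.
    set (r := p1 x / (p1 x + p2 x)) in *. set (s := p2 x / (p1 x + p2 x)) in *.
    assert (Sum : logw f p1 x + logw f p2 x + logw g q1 x + logw g q2 x = 0).
    { apply (Rmult_eq_reg_l (r * s)).
      - rewrite Rmult_0_r. lra.
      - apply Rmult_integral_contrapositive_currified; lra. }
    specialize (L x Ix). unfold logw in *. lra. }
  assert (R3 : forall x, I x ->
    Derive (logw g q1) x = - Derive (logw f p1) x /\
    Derive (logw g q2) x = - Derive (logw f p2) x).
  { intros x Ix. rewrite <- !Derive_opp.
    split; apply Derive_ext_loc; generalize (oI x Ix); apply filter_imp;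
      intros t It; apply (R2 t It). }
  assert (Dk := fun x Ix => is_derive_kap I f x Hf Ix (Nf x Ix)).
  assert (Dk' := fun x Ix => is_derive_kap I g x Hg Ix (Ng x Ix)).
  assert (K : forall x, I x -> kap f x - kap g x = 0).
  { apply (zero_off_nowhere_dense I _ (fun x => kap f x - kap g x) oI ND).
    - intros x Ix. apply (continuous_minus (kap f) (kap g)).
      + exact (is_derive_continuous _ _ _ (Dk x Ix)).
      + exact (is_derive_continuous _ _ _ (Dk' x Ix)).
    - intros x Ix. destruct (X x Ix) as (_ & _ & H & _). simpl in H.
      destruct (RS x Ix) as (Er & Es & S1 & Hr & Hs & Hd). rewrite Er, Es in H.
      destruct (R2 x Ix) as (-> & ->) in H. destruct (R3 x Ix) as (-> & _) in H.
      set (r := p1 x / (p1 x + p2 x)) in *. set (s := p2 x / (p1 x + p2 x)) in *.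
      destruct (Req_dec r s) as [ Ers | Nrs ]; [ left; auto | right ].
      assert (Hrs := Rmult_lt_0_compat _ _ Hr Hs).
      assert (T : (r * s) * ((r - s) * (kap f x - kap g x)) = 0)
        by (rewrite <- H; ring).
      apply Rmult_integral in T as [T | T]; [ lra | ].
      apply Rmult_integral in T as [T | T]; [ | exact T ].
      exfalso; apply Nrs; lra. }
  assert (K' : forall x, I x -> is_derive (kap f) x 0).
  { intros x Ix.
    replace 0 with (Derive (kap f) x).
    { apply Derive_correct. eexists. exact (Dk x Ix). }
    assert (Eg : Derive (kap g) x = Derive (kap f) x).
    { apply Derive_ext_loc. generalize (oI x Ix); apply filter_imp.
      intros t It. specialize (K t It). lra. }
    destruct (X x Ix) as (_ & _ & _ & H). simpl in H.
    destruct (RS x Ix) as (Er & Es & S1 & Hr & Hs & Hd). rewrite Er, Es, Eg in H.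
    destruct (R2 x Ix) as (E1 & E2). destruct (R3 x Ix) as (E3 & E4).
    rewrite E1, E2, E3, E4 in H.
    replace (kap g x) with (kap f x) in H by (specialize (K x Ix); lra).
    set (r := p1 x / (p1 x + p2 x)) in *. set (s := p2 x / (p1 x + p2 x)) in *.
    assert (Hrs := Rmult_lt_0_compat _ _ Hr Hs).
    assert (T : (r * s) * ((r * s) * Derive (kap f) x) = 0)
      by (rewrite <- (Rmult_0_r (/ 4)), <- H; field).
    apply Rmult_integral in T as [T | T]; [ lra | ].
    apply Rmult_integral in T as [T | T]; [ lra | exact T ]. }
  destruct (proj1 (proj2 hI)) as [x0 I0].
  exists (kap f x0). intros x Ix.
  assert (Kx := constant_on I (kap f) x x0 hI K' Ix I0).
  specialize (K x Ix). destruct (R2 x Ix) as (E1 & _).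
  repeat split; try lra. exact (R1 x Ix).
Qed.

(** * From the linear equation to global invariance *)

(** Energy estimate: with [C = 1 + |gamma|] the quantity
    [(phi^2 + phi'^2) * exp (- C |s|)] does not increase as [|s|] grows. *)
Lemma zero_initial_data (gamma T : R) (phi phi1 : R -> R) :
  (forall s, Rmin 0 T <= s <= Rmax 0 T ->
     is_derive phi s (phi1 s) /\ is_derive phi1 s (gamma * phi s)) ->
  phi 0 = 0 -> phi1 0 = 0 -> phi T = 0.
Proof.
  intros D Z Z1.
  assert (Hsg : exists sg, (sg = 1 \/ sg = -1) /\ 0 <= sg * T).
  { destruct (Rle_dec 0 T); [ exists 1 | exists (-1) ]; split; auto; lra. }
  destruct Hsg as (sg & Hsg & PT).
  set (C := 1 + Rabs gamma).
  set (E := fun s => (phi s * phi s + phi1 s * phi1 s) * exp (- (C * sg) * s)).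
  set (dE := fun s => (2 * (1 + gamma) * (phi s * phi1 s)
    - C * sg * (phi s * phi s + phi1 s * phi1 s)) * exp (- (C * sg) * s)).
  assert (DE : forall s, Rmin 0 T <= s <= Rmax 0 T -> is_derive E s (dE s)).
  { intros s Hs. destruct (D s Hs) as [d1 d2].
    assert (de : is_derive (fun s => exp (- (C * sg) * s)) s
                   (exp (- (C * sg) * s) * (- (C * sg) * 1))).
    { apply (is_derive_Rcomp exp (fun s => - (C * sg) * s)).
      - apply is_derive_exp.
      - exact (is_derive_scal _ _ (- (C * sg)) _ (is_derive_id (K := R_AbsRing) s)). }
    evar_last.
    - exact (is_derive_Rmult _ _ _ _ _
        (is_derive_Rplus _ _ _ _ _ (is_derive_Rmult _ _ _ _ _ d1 d1)
          (is_derive_Rmult _ _ _ _ _ d2 d2)) de).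
    - unfold dE. apply Rminus_diag_uniq. ring. }
  destruct (MVT_gen E 0 T dE) as (c & _ & Ec).
  - intros s Hs. apply DE. lra.
  - intros s Hs. apply continuity_pt_filterlim.
    exact (is_derive_continuous _ _ _ (DE s Hs)).
  - assert (E0 : E 0 = 0) by (unfold E; rewrite Z, Z1; ring).
    assert (Q : sg * dE c <= 0).
    { unfold dE. set (p := phi c). set (p' := phi1 c).
      assert (He := exp_pos (- (C * sg) * c)).
      assert (Hg : - C <= sg * (1 + gamma) <= C).
      { unfold C. assert (X := Rle_abs gamma). assert (Y := Rle_abs (- gamma)).
        rewrite Rabs_Ropp in Y. destruct Hsg; subst sg; lra. }
      assert (Hb : 2 * (sg * (1 + gamma)) * (p * p') <= C * (p * p + p' * p')).
      { assert (S1 := Rle_0_sqr (p - p')). assert (S2 := Rle_0_sqr (p + p')).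
        unfold Rsqr in S1, S2. nra. }
      assert (Hs2 : sg * sg = 1) by (destruct Hsg; subst sg; ring).
      replace (sg * ((2 * (1 + gamma) * (p * p') - C * sg * (p * p + p' * p'))
                * exp (- (C * sg) * c)))
        with ((2 * (sg * (1 + gamma)) * (p * p') - (sg * sg) * (C * (p * p + p' * p')))
                * exp (- (C * sg) * c)) by ring.
      rewrite Hs2. nra. }
    assert (Ele : E T <= 0).
    { rewrite E0, Rminus_0_r, Rminus_0_r in Ec. rewrite Ec.
      destruct Hsg; subst sg; nra. }
    unfold E in Ele. assert (He := exp_pos (- (C * sg) * T)).
    assert (phi T * phi T + phi1 T * phi1 T <= 0) by nra.
    nra.
Qed.

Definition wronskian (u v : R -> R) (x : R) : R :=
  Derive u x * v x - u x * Derive v x.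

Lemma is_derive_wronskian (I : R -> Prop) (gamma : R) (u v : R -> R) (x : R) :
  solution_on I gamma u -> solution_on I gamma v -> I x ->
  is_derive (wronskian u v) x 0.
Proof.
  intros Su Sv Ix. destruct (Su x Ix) as [u1 u2]. destruct (Sv x Ix) as [v1 v2].
  apply Derive_correct in u1, v1.
  evar_last.
  - exact (is_derive_minus _ _ _ _ _ (is_derive_Rmult _ _ _ _ _ u2 v1)
             (is_derive_Rmult _ _ _ _ _ u1 v2)).
  - unfold minus, plus, opp; simpl. ring.
Qed.

Lemma is_derive_quotient_of_solutions (I : R -> Prop) (gamma : R) (f u v : R -> R)
  (x : R) :
  open I -> solution_on I gamma u -> solution_on I gamma v -> positive_on I v ->
  (forall t, I t -> f t = u t / v t) -> I x ->
  Derive f x = wronskian u v x / v x ^ 2.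
Proof.
  intros oI Su Sv Pv E Ix.
  apply is_derive_unique. apply (is_derive_ext_loc (fun t => u t / v t)).
  - generalize (oI x Ix); apply filter_imp. intros t It. symmetry; auto.
  - apply is_derive_div.
    + apply Derive_correct, (proj1 (Su x Ix)).
    + apply Derive_correct, (proj1 (Sv x Ix)).
    + specialize (Pv x Ix). lra.
Qed.

(** As a function of [s], the kernel [u s * v a - u a * v s] divided by the
    Wronskian solves the initial value problem with data [0, 1] at [a]; hence it
    depends only on [s - a] and on [gamma]. *)
Lemma kernel_translation (I : R -> Prop) (gamma : R) (u v w z : R -> R) (a b T : R) :
  nonempty_open_interval I ->
  solution_on I gamma u -> solution_on I gamma v ->
  solution_on I gamma w -> solution_on I gamma z ->
  I a -> I (a + T) -> I b -> I (b + T) ->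
  (u (a + T) * v a - u a * v (a + T)) * wronskian w z b
  = (w (b + T) * z b - w b * z (b + T)) * wronskian u v a.
Proof.
  intros hI Su Sv Sw Sz Ia IaT Ib IbT.
  set (u0 := u a). set (v0 := v a). set (w0 := w b). set (z0 := z b).
  set (W := wronskian u v a). set (W' := wronskian w z b).
  assert (Between : forall x s, I x -> I (x + T) ->
    Rmin 0 T <= s <= Rmax 0 T -> I (x + s)).
  { intros x s Ix IxT Hs. apply (interval_between I x (x + T)); trivial.
    revert Hs; unfold Rmin, Rmax.
    destruct (Rle_dec 0 T), (Rle_dec x (x + T)); lra. }
  assert (Shift : forall (h : R -> R) x s d, is_derive h (x + s) d ->
    is_derive (fun s => h (x + s)) s d).
  { intros h x s d Dh. rewrite <- (Rmult_1_r d).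
    apply (is_derive_Rcomp h (fun s => x + s)); trivial.
    rewrite <- (Rplus_0_l 1). apply (is_derive_Rplus (fun _ => x) (fun s => s)).
    - apply (is_derive_const (V := R_NormedModule)).
    - apply (is_derive_id (K := R_AbsRing)). }
  (* difference of the two sides with [s] in place of [T] *)
  set (comb := fun (u v w z : R -> R) s =>
    ((v0 * W') * u (a + s) + (- (u0 * W')) * v (a + s))
    + ((- (z0 * W)) * w (b + s) + (w0 * W) * z (b + s))).
  assert (Dcomb : forall (h k l m h' k' l' m' : R -> R) s,
    is_derive h (a + s) (h' (a + s)) -> is_derive k (a + s) (k' (a + s)) ->
    is_derive l (b + s) (l' (b + s)) -> is_derive m (b + s) (m' (b + s)) ->
    is_derive (comb h k l m) s (comb h' k' l' m' s)).
  { intros h k l m h' k' l' m' s Dh Dk Dl Dm.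
    exact (is_derive_Rplus _ _ _ _ _
      (is_derive_Rplus _ _ _ _ _ (is_derive_scal _ _ _ _ (Shift _ _ _ _ Dh))
         (is_derive_scal _ _ _ _ (Shift _ _ _ _ Dk)))
      (is_derive_Rplus _ _ _ _ _ (is_derive_scal _ _ _ _ (Shift _ _ _ _ Dl))
         (is_derive_scal _ _ _ _ (Shift _ _ _ _ Dm)))). }
  assert (H : comb u v w z T = 0).
  { apply (zero_initial_data gamma T _ (comb (Derive u) (Derive v) (Derive w) (Derive z))).
    - intros s Hs.
      assert (Ias := Between a s Ia IaT Hs). assert (Ibs := Between b s Ib IbT Hs).
      destruct (Su _ Ias) as [u1 u2]. destruct (Sv _ Ias) as [v1 v2].
      destruct (Sw _ Ibs) as [w1 w2]. destruct (Sz _ Ibs) as [z1 z2].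
      apply Derive_correct in u1, v1, w1, z1.
      split; [ apply Dcomb; assumption | ].
      evar_last.
      + apply (Dcomb _ _ _ _ (fun t => gamma * u t) (fun t => gamma * v t)
                 (fun t => gamma * w t) (fun t => gamma * z t)); assumption.
      + unfold comb. apply Rminus_diag_uniq. ring.
    - unfold comb, u0, v0, w0, z0. rewrite !Rplus_0_r. ring.
    - unfold comb, u0, v0, w0, z0, W, W', wronskian. rewrite !Rplus_0_r. ring. }
  apply Rminus_diag_uniq. rewrite <- H. unfold comb. ring.
Qed.

(** The kernel identities turn the equation satisfied by [a = A x y] into the one
    that characterizes [x + y - a] as the mean of [g] and [q]. *)
Lemma invariance_of_solutions (I : R -> Prop) (gamma : R)
  (f g p1 p2 q1 q2 u v w z : R -> R) (x y : R) :
  nonempty_open_interval I -> cont_diff_on 2 I f -> cont_diff_on 2 I g ->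
  (forall x, I x -> Derive f x <> 0) -> (forall x, I x -> Derive g x <> 0) ->
  positive_on I p1 -> positive_on I p2 -> positive_on I q1 -> positive_on I q2 ->
  solution_on I gamma u -> solution_on I gamma v ->
  solution_on I gamma w -> solution_on I gamma z ->
  positive_on I v -> positive_on I z ->
  (forall t, I t -> f t = u t / v t /\ g t = w t / z t /\
     p1 t * q1 t = v t * z t /\ p2 t * q2 t = v t * z t) ->
  I x -> I y ->
  bajraktarevic I f p1 p2 x y + bajraktarevic I g q1 q2 x y = x + y.
Proof.
  intros hI Hf Hg Nf Ng P1 P2 Q1 Q2 Su Sv Sw Sz Pv Pz E Ix Iy.
  destruct (bajraktarevic_spec I f p1 p2 x y hI Hf Nf P1 P2 Ix Iy) as (Ha & Ia & EA).
  set (a := bajraktarevic I f p1 p2 x y) in *.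
  set (b := x + y - a).
  assert (Ib : I b).
  { apply (interval_between I x y); trivial. unfold b.
    revert Ha; unfold Rmin, Rmax. destruct (Rle_dec x y); lra. }
  rewrite (bajraktarevic_unique I g q1 q2 x y b); trivial; [ unfold b; ring | ].
  assert (Wa : wronskian u v a = wronskian u v x).
  { apply (constant_on I); trivial. intros t.
    apply (is_derive_wronskian I gamma); trivial. }
  assert (Wb : wronskian w z b = wronskian w z x).
  { apply (constant_on I); trivial. intros t.
    apply (is_derive_wronskian I gamma); trivial. }
  assert (Wx : wronskian u v x <> 0).
  { intros Z. apply (Nf x Ix).
    rewrite (is_derive_quotient_of_solutions I gamma f u v x (proj1 hI)); trivial.
    - rewrite Z. unfold Rdiv. ring.
    - intros t It. exact (proj1 (E t It)). }
  (* [y - a = b - x] and [a - x = y - b] *)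
  assert (Iy' : I (a + (y - a))) by (rewrite Rplus_minus; exact Iy).
  assert (Exb : x + (y - a) = b) by (unfold b; ring).
  assert (Eby : b + (a - x) = y) by (unfold b; ring).
  assert (K1 := kernel_translation I gamma u v w z a x (y - a) hI Su Sv Sw Sz Ia Iy' Ix
                  ltac:(rewrite Exb; exact Ib)).
  assert (K2 := kernel_translation I gamma u v w z x b (a - x) hI Su Sv Sw Sz Ix
                  ltac:(rewrite Rplus_minus; exact Ia) Ib ltac:(rewrite Eby; exact Iy)).
  rewrite (Rplus_minus a y) in K1. rewrite (Rplus_minus x a) in K2.
  rewrite Exb, Wa in K1. rewrite Eby, Wb in K2.
  destruct (E x Ix) as (Efx & Egx & Ex & _). destruct (E y Iy) as (Efy & Egy & _ & Ey).
  destruct (E a Ia) as (Efa & _). destruct (E b Ib) as (_ & Egb & _).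
  specialize (P1 x Ix). specialize (P2 y Iy).
  assert (Vx := Pv x Ix). assert (Vy := Pv y Iy). assert (Va := Pv a Ia).
  assert (Zx := Pz x Ix). assert (Zy := Pz y Iy). assert (Zb := Pz b Ib).
  rewrite Efx, Efy, Efa in EA. rewrite Egx, Egy, Egb.
  assert (EA' : p1 x * v y * (u a * v x - u x * v a)
                - p2 y * v x * (u y * v a - u a * v y) = 0).
  { rewrite <- (Rmult_0_r (v a * v x * v y)), <- EA. field. lra. }
  assert (EB' : p1 x * v y * (w y * z b - w b * z y)
                - p2 y * v x * (w b * z x - w x * z b) = 0).
  { apply (Rmult_eq_reg_r (wronskian u v x)); trivial.
    transitivity ((p1 x * v y * (u a * v x - u x * v a)
                - p2 y * v x * (u y * v a - u a * v y)) * wronskian w z x).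
    - rewrite Rmult_minus_distr_r, Rmult_minus_distr_r, !Rmult_assoc.
      rewrite <- K1, <- K2. reflexivity.
    - rewrite EA'. ring. }
  assert (Eq1 : q1 x = v x * z x / p1 x) by (rewrite <- Ex; field; lra).
  assert (Eq2 : q2 y = v y * z y / p2 y) by (rewrite <- Ey; field; lra).
  rewrite Eq1, Eq2.
  rewrite <- (Rmult_0_r (- / (p1 x * p2 y * z b))), <- EB'. field. lra.
Qed.

(** The solutions are [v = 1 / sqrt |f'|], [u = f v], [z = p1 q1 / v], [w = g z];
    that the logarithmic derivatives of [p1 sqrt |f'|] and [q1 sqrt |g'|] add up
    to zero means that [z] is [1 / sqrt |g'|] up to a constant factor. *)
Lemma solutions_of_kap (I : R -> Prop) (gamma : R) (f g p1 p2 q1 q2 : R -> R) :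
  nonempty_open_interval I -> cont_diff_on 4 I f -> cont_diff_on 4 I g ->
  (forall x, I x -> Derive f x <> 0) -> (forall x, I x -> Derive g x <> 0) ->
  positive_on I p1 -> positive_on I q1 ->
  cont_diff_on 2 I p1 -> cont_diff_on 2 I q1 ->
  (forall x, I x ->
    kap f x = gamma /\ kap g x = gamma /\ p1 x * q1 x = p2 x * q2 x /\
    logw f p1 x + logw g q1 x = 0) ->
  exists u v w z : R -> R,
    (solution_on I gamma u /\ solution_on I gamma v /\
     solution_on I gamma w /\ solution_on I gamma z) /\
    positive_on I v /\ positive_on I z /\
    lin_indep_on I u v /\ lin_indep_on I w z /\
    (forall x, I x ->
       f x = u x / v x /\ g x = w x / z x /\
       p1 x * q1 x = v x * z x /\ p2 x * q2 x = v x * z x).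
Proof.
  intros hI Hf Hg Nf Ng P1 Q1 C1 D1 H.
  assert (oI := proj1 hI).
  destruct (derive_sign I f hI) as (s & Hs & Pos); trivial.
  { intros x. apply (cont_diff_continuous 4 1 I f); trivial; lia. }
  assert (Hss : s * s = 1) by (destruct Hs; subst s; ring).
  set (v := fun x => / sqrt (s * Derive f x)).
  set (z := fun x => p1 x * q1 x / v x).
  assert (Vpos : positive_on I v).
  { intros x Ix. apply Rinv_0_lt_compat, sqrt_lt_R0. exact (Pos x Ix). }
  assert (Zpos : positive_on I z).
  { intros x Ix. apply Rdiv_lt_0_compat; [ | exact (Vpos x Ix) ].
    exact (Rmult_lt_0_compat _ _ (P1 x Ix) (Q1 x Ix)). }
  assert (Dv : forall x, I x ->
    is_derive v x (- / 2 * (Derive_n f 2 x / Derive_n f 1 x) * v x)).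
  { intros x Ix. specialize (Pos x Ix). specialize (Nf x Ix).
    assert (Sq := sqrt_lt_R0 _ Pos).
    assert (D2 : is_derive (Derive f) x (Derive_n f 2 x))
      by exact (cont_diff_is_derive 4 1 I f x Hf ltac:(lia) Ix).
    evar_last.
    - apply (is_derive_inv (fun t => sqrt (s * Derive f t))); [ | lra ].
      apply (is_derive_sqrt (fun t => s * Derive f t)); trivial.
      exact (is_derive_scal _ _ s _ D2).
    - change (Derive_n f 1 x) with (Derive f x). unfold v.
      apply Rminus_diag_uniq.
      set (q := sqrt (s * Derive f x)) in *.
      assert (Eq : Derive f x = s * (q * q)).
      { unfold q. rewrite sqrt_sqrt by lra. rewrite <- Rmult_assoc, Hss. ring. }
      assert (s <> 0) by (destruct Hs; lra).
      assert (Es : s = / s)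
        by (apply (Rmult_eq_reg_l s); trivial; rewrite Hss; field; trivial).
      rewrite Eq. rewrite Es at 1. field. split; lra. }
  assert (Dz : forall x, I x ->
    is_derive z x (- / 2 * (Derive_n g 2 x / Derive_n g 1 x) * z x)).
  { intros x Ix.
    assert (Dp : is_derive p1 x (Derive p1 x))
      by exact (cont_diff_is_derive 2 0 I p1 x C1 ltac:(lia) Ix).
    assert (Dq : is_derive q1 x (Derive q1 x))
      by exact (cont_diff_is_derive 2 0 I q1 x D1 ltac:(lia) Ix).
    destruct (H x Ix) as (_ & _ & _ & L).
    specialize (Nf x Ix). specialize (Ng x Ix). specialize (Vpos x Ix).
    specialize (P1 x Ix). specialize (Q1 x Ix).
    evar_last.
    - exact (is_derive_div _ _ _ _ _ (is_derive_Rmult _ _ _ _ _ Dp Dq) (Dv x Ix)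
               (Rgt_not_eq _ _ Vpos)).
    - change (Derive_n f 1 x) with (Derive f x).
      change (Derive_n g 1 x) with (Derive g x).
      unfold logw in L. apply Rminus_diag_uniq.
      rewrite <- (Rmult_0_r (z x)), <- L. unfold z. field. repeat split; lra. }
  destruct (solutions_of_constant_kap I gamma f v oI Hf Nf) as [Sv Su]; trivial.
  { intros x Ix. exact (proj1 (H x Ix)). }
  destruct (solutions_of_constant_kap I gamma g z oI Hg Ng) as [Sz Sw]; trivial.
  { intros x Ix. exact (proj1 (proj2 (H x Ix))). }
  exists (fun x => f x * v x), v, (fun x => g x * z x), z.
  refine (conj (conj Su (conj Sv (conj Sw Sz))) (conj Vpos (conj Zpos
    (conj (lin_indep_quotient I f v hI Vpos Nf)
       (conj (lin_indep_quotient I g z hI Zpos Ng) _))))).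
  intros x Ix. specialize (Vpos x Ix). specialize (Zpos x Ix).
  assert (Epq : p1 x * q1 x = v x * z x) by (unfold z; field; lra).
  split; [ field; lra | ]. split; [ field; lra | ]. split; [ exact Epq | ].
  rewrite <- Epq. symmetry. exact (proj1 (proj2 (proj2 (H x Ix)))).
Qed.

Lemma all_equivalent_cycle (P Q R S : Prop) :
  (P -> Q) -> (Q -> R) -> (R -> S) -> (S -> P) -> all_equivalent [P; Q; R; S].
Proof.
  intros PQ QR RS SP X Y HX HY. simpl in HX, HY.
  destruct HX as [<- | [<- | [<- | [<- | []]]]];
  destruct HY as [<- | [<- | [<- | [<- | []]]]]; tauto.
Qed.

Lemma neighborhood_locally_invariant (I : R -> Prop) (A B : R -> R -> R)
  (U : R * R -> Prop) :
  open U -> (forall x y, U (x, y) -> I x /\ I y) -> (forall x, I x -> U (x, x)) ->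
  (forall x y, U (x, y) -> A x y + B x y = x + y) -> locally_invariant I A B.
Proof.
  intros oU UI diag E x Ix.
  destruct (oU (x, x) (diag x Ix)) as [e He].
  exists e. intros s t Hs Ht.
  assert (Ust : U (s, t)) by (apply He; split; assumption).
  destruct (UI s t Ust) as [Is It]. auto.
Qed.

Lemma locally_invariant_swap (I : R -> Prop) (f g p1 p2 q1 q2 : R -> R) :
  locally_invariant I (bajraktarevic I f p1 p2) (bajraktarevic I g q1 q2) ->
  locally_invariant I (bajraktarevic I f p2 p1) (bajraktarevic I g q2 q1).
Proof.
  intros Inv x Ix. destruct (Inv x Ix) as [e He].
  exists e. intros s t Hs Ht. destruct (He t s Ht Hs) as (It & Is & E).
  rewrite (bajraktarevic_swap I f p2 p1), (bajraktarevic_swap I g q2 q1).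
  repeat split; trivial. lra.
Qed.

Theorem theorem10
  (I : R -> Prop) (hI : nonempty_open_interval I)
  (f g : R -> R)
  (hf : cont_diff_on 4 I f) (hg : cont_diff_on 4 I g)
  (hf' : forall x : R, I x -> Derive f x <> 0)
  (hg' : forall x : R, I x -> Derive g x <> 0)
  (p1 p2 q1 q2 : R -> R)
  (hp1 : positive_on I p1) (hp2 : positive_on I p2)
  (hp1_C2 : cont_diff_on 2 I p1) (hp2_C2 : cont_diff_on 2 I p2)
  (hq1 : positive_on I q1) (hq2 : positive_on I q2)
  (hP : nowhere_dense_in I (fun x : R => I x /\ p1 x = p2 x)) :
  let A : R -> R -> R := bajraktarevic I f p1 p2 in
  let B : R -> R -> R := bajraktarevic I g q1 q2 in
  all_equivalent
    [ (* (i) *)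
      (forall x y : R, I x -> I y -> A x y + B x y = x + y) ;
      (* (ii) *)
      (exists U : R * R -> Prop,
         open U /\
         (forall x y : R, U (x, y) -> I x /\ I y) /\
         (forall x : R, I x -> U (x, x)) /\
         (forall x y : R, U (x, y) -> A x y + B x y = x + y)) ;
      (* (iii) *)
      (cont_diff_on 2 I q1 /\ cont_diff_on 2 I q2 /\
       (forall x : R, I x ->
          partial_derive 1 0 A x x + partial_derive 1 0 B x x = 1 /\
          partial_derive 1 1 A x x + partial_derive 1 1 B x x = 0 /\
          partial_derive 2 1 A x x + partial_derive 2 1 B x x = 0 /\
          partial_derive 2 2 A x x + partial_derive 2 2 B x x = 0)) ;
      (* (iv) *)
      (exists (gamma : R) (u v w z : R -> R),
         (solution_on I gamma u /\ solution_on I gamma v /\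
          solution_on I gamma w /\ solution_on I gamma z) /\
         positive_on I v /\ positive_on I z /\
         lin_indep_on I u v /\ lin_indep_on I w z /\
         (forall x : R, I x ->
            f x = u x / v x /\
            g x = w x / z x /\
            p1 x * q1 x = v x * z x /\
            p2 x * q2 x = v x * z x)) ].
Proof.
  intros A B. assert (oI := proj1 hI).
  assert (hf2 : cont_diff_on 2 I f) by (apply (cont_diff_le 2 4); trivial; lia).
  assert (hg2 : cont_diff_on 2 I g) by (apply (cont_diff_le 2 4); trivial; lia).
  apply all_equivalent_cycle.
  - intros Inv. exists (fun xy => I (fst xy) /\ I (snd xy)). repeat split.
    + intros [x y] [Ix Iy].
      destruct (oI x Ix) as [e1 H1]. destruct (oI y Iy) as [e2 H2].
      exists (mkposreal _ (Rmin_pos _ _ (cond_pos e1) (cond_pos e2))).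
      intros [s t] [Bs Bt]. split.
      * apply H1. exact (Rlt_le_trans _ _ _ Bs (Rmin_l _ _)).
      * apply H2. exact (Rlt_le_trans _ _ _ Bt (Rmin_r _ _)).
    + exact (proj1 H).
    + exact (proj2 H).
    + exact H.
    + exact H.
    + intros x y [Ix Iy]. exact (Inv x y Ix Iy).
  - intros (U & oU & UI & diag & E).
    assert (Inv := neighborhood_locally_invariant I A B U oU UI diag E).
    assert (D1 : cont_diff_on 2 I q1)
      by exact (weight_regular I f g p1 p2 q1 q2 hI hf2 hg2 hf' hg' hp1 hp2 hq1 hq2
                  hp1_C2 Inv).
    assert (D2 : cont_diff_on 2 I q2)
      by exact (weight_regular I f g p2 p1 q2 q1 hI hf2 hg2 hf' hg' hp2 hp1 hq2 hq1
                  hp2_C2 (locally_invariant_swap I f g p1 p2 q1 q2 Inv)).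
    split; [ exact D1 | ]. split; [ exact D2 | ]. intros x Ix.
    exact (invariance_partials I f g p1 p2 q1 q2 x hI hf hg hf' hg' hp1 hp2 hq1 hq2
             hp1_C2 hp2_C2 D1 D2 Inv Ix).
  - intros (D1 & D2 & E).
    destruct (partials_imply_kap I f g p1 p2 q1 q2 hI hf hg hf' hg' hp1 hp2 hq1 hq2
                hp1_C2 hp2_C2 D1 D2 hP E) as (gamma & H).
    exists gamma.
    exact (solutions_of_kap I gamma f g p1 p2 q1 q2 hI hf hg hf' hg' hp1 hq1
             hp1_C2 D1 H).
  - intros (gamma & u & v & w & z & (Su & Sv & Sw & Sz) & Pv & Pz & _ & _ & E) x y Ix Iy.
    exact (invariance_of_solutions I gamma f g p1 p2 q1 q2 u v w z x y hI hf2 hg2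
             hf' hg' hp1 hp2 hq1 hq2 Su Sv Sw Sz Pv Pz E Ix Iy).
Qed.
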